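(* Let $(N_x(n))_{n\in\mathbb{N}_0}$, $x\in\mathbb{Z}$, be independent copies of the stationary renewal chain with interarrival distribution $p_n=Z^{-1}e^{-n^{1/4}}$, $n\in\mathbb{N}_0$ (each started from its stationary distribution $q$). If $R$ is large enough, then $$\mathbb{P}_q\Big[\text{there exists } g:\mathbb{N}_0\to\mathbb{Z} \text{ with } g(0)=0,\ |g(n+1)-g(n)|\le R \text{ and } N_{g(n)}(n)=0 \text{ for all } n\in\mathbb{N}_0\Big]>0 .$$
   Context: $\mathbb{N}_0=\{0,1,2,\dots\}$ and $Z=\sum_{n\in\mathbb{N}_0}e^{-n^{1/4}}$. The renewal chain with interarrival distribution $p$ is the discrete-time Markov chain on $\mathbb{N}_0$ with transition probabilities $g(l,m)=\mathbf{1}\{m=l-1\}$ if $l>0$, and $g(0,m)=p_m$. Its stationary distribution is $q_n=\frac1{Z'}\sum_{j\ge n}e^{-j^{1/4}}$ with $Z'=\sum_{n\in\mathbb{N}_0}\sum_{j\ge n}e^{-j^{1/4}}$. $\mathbb{P}_q$ is the law of the family of independent chains $(N_x)_{x\in\mathbb{Z}}$ with $N_x(0)\sim q$ independently for each $x\in\mathbb{Z}$. A space-time site $(x,n)$ is open if $N_x(n)=0$. *)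

(* Defs.v *)
From HB Require Import structures.
From mathcomp Require Import all_boot all_order all_algebra.
From mathcomp Require Import finmap.
From mathcomp Require Import all_classical all_reals all_analysis.

Set Implicit Arguments.
Unset Strict Implicit.
Unset Printing Implicit Defensive.

Import Order.TTheory GRing.Theory Num.Theory.
Import numFieldNormedType.Exports.
Local Open Scope classical_set_scope.
Local Open Scope ring_scope.

(* e^{-n^{1/4}}; since 0 `^ a = 0 for a != 0, the value at n = 0 is 1. *)
Definition weight (K : realType) (n : nat) : K :=
  expR (- (n%:R `^ (4^-1))).

(* The sum of u_j over j >= n. limn is total but meaningful only for convergent
   series, as are all those used below. *)
Definition sum_from (K : realType) (n : nat) (u : nat -> K) : K :=
  limn (fun m => \sum_(n <= j < m) u j).

Definition tail_weight (K : realType) (n : nat) : K :=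
  sum_from n (weight K).

Definition interarrival (K : realType) (n : nat) : K :=
  weight K n / sum_from 0 (weight K).

Definition stationary (K : realType) (n : nat) : K :=
  tail_weight K n / sum_from 0 (tail_weight K).

Definition renewal_trans (K : realType) (p : nat -> K) (l m : nat) : K :=
  if (0 < l)%N then (m == l.-1)%:R else p m.

(* The Markov property P[X_(n+1) = b | X_0 = a_0, ..., X_n = a_n] = g(a_n, b)
   is multiplied out by the probability of the conditioning event, so that
   nothing is required when that event is null. *)
Definition is_markov_chain (K : realType) (d : measure_display)
    (T : measurableType d) (P : probability T K)
    (init : nat -> K) (trans : nat -> nat -> K) (X : nat -> {RV P >-> nat}) :=
  (forall a : nat, P [set w | X 0%N w = a] = (init a)%:E) /\
  (forall (n : nat) (a : nat -> nat) (b : nat),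
     P [set w | (forall i, (i <= n)%N -> X i w = a i) /\ X n.+1 w = b] =
     (P [set w | forall i, (i <= n)%N -> X i w = a i] * (trans (a n) b)%:E)%E).

Definition process_sigma_algebra (K : realType) (d : measure_display)
    (T : measurableType d) (P : probability T K) (X : nat -> {RV P >-> nat}) :
    set (set T) :=
  <<s \bigcup_n preimage_set_system setT (X n) measurable >>.

Definition mutually_independent (K : realType) (d : measure_display)
    (T : measurableType d) (P : probability T K) (I : choiceType)
    (F : I -> set (set T)) :=
  forall (J : {fset I}) (A : I -> set T),
    (forall i, i \in J -> F i (A i)) ->
    P (\bigcap_(i in [set` J]) A i) = (\prod_(i <- J) P (A i))%E.

(* The joint law of N under P is P_q. *)
Definition renewal_family (K : realType) (d : measure_display)
    (T : measurableType d) (P : probability T K)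
    (N : int -> nat -> {RV P >-> nat}) :=
  (forall x : int, is_markov_chain (stationary K)
                     (renewal_trans (interarrival K)) (N x)) /\
  mutually_independent P (fun x : int => process_sigma_algebra (N x)).

(* Main.v *)
Require Import Defs.
From HB Require Import structures.
From mathcomp Require Import all_boot all_order all_algebra.
From mathcomp Require Import finmap.
From mathcomp Require Import all_classical all_reals all_analysis.
From mathcomp Require Import measurable_realfun zify ring lra.

(* Cut Z into rows of B consecutive columns, and call a row closed at time n if all its
   columns are; it suffices to find a 1-Lipschitz function of time whose rows are never
   closed. Long gaps make closed rows strongly correlated in time, so closed sites are
   sorted by scale: a site of a closed row is bad of scale i if a proportion (i+1)/2^(i+2)
   of its columns has residual waiting time in [16^i, 16^(i+1)), and it condemns the
   16-adic time interval of length 16^(i+1) around it, a wall. Bad sites in distinct walls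
   behave independently: tilting each column by exp(e 2^i) at a matching site and by 0 at
   an open one gives expectation at most 1, because a gap meets at most two walls of
   each scale up to its own, so that the tilt of a gap of length l is at most
   exp(4 e l^(1/4)). Hence r bad sites of scales i_1, ..., i_r in distinct walls have
   probability at most the product of the kappa^(i_j+1) with kappa = exp(-e B / 4), which
   beats the number of paths in the Peierls argument of Lipschitz percolation. *)

Set Implicit Arguments.
Unset Strict Implicit.
Unset Printing Implicit Defensive.

Import Order.TTheory GRing.Theory Num.Theory.
Import numFieldNormedType.Exports.
Local Open Scope classical_set_scope.
Local Open Scope ring_scope.

(** * Tilted expectations of a renewal chain *)

Section Renewal.
Context (K : realType).
Implicit Types (p q m : nat -> K) (w : nat -> nat -> K).

Lemma nneseries_recS (f : nat -> \bar K) : (forall i, 0 <= f i)%E ->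
  (\sum_(i <oo) f i = f 0%N + \sum_(i <oo) f i.+1)%E.
Proof.
move=> f0; rewrite nneseries_recl// -(nneseries_addn 1 f0).
by congr (_ + _)%E; apply: eq_eseriesr => i _; rewrite addn1.
Qed.

Definition renewal_step p m : nat -> K := fun b => m b.+1 + m 0%N * p b.

(* [tilt p w h t l] is the expectation of [w t (X 0) * ... * w (t + h - 1) (X (h - 1))]
   for the renewal chain [X] started at [l]. *)
Fixpoint tilt p w (h t l : nat) : \bar K :=
  if h is h'.+1 then
    ((w t l)%:E * (if l is l'.+1 then tilt p w h' t.+1 l'
                   else \sum_(j <oo) (p j)%:E * tilt p w h' t.+1 j))%E
  else 1%E.

Lemma tilt_ge0 p w h t l : (forall j, 0 <= p j) -> (forall n j, 0 <= w n j) ->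
  (0 <= tilt p w h t l)%E.
Proof.
move=> p0 w0; elim: h t l => //= h IH t l.
rewrite mule_ge0 ?lee_fin//; case: l => // .
by apply: nneseries_ge0 => j _ _; rewrite mule_ge0 ?lee_fin.
Qed.

(** Duality: the first weight and the first step pass from the expectation to the mass function. The
    two terms of [renewal_step] come from the positive states and from state 0. *)
Lemma tilt_pairing p w m h t : (forall j, 0 <= p j) -> (forall n j, 0 <= w n j) ->
  (forall j, 0 <= m j) ->
  (\sum_(l <oo) (m l)%:E * tilt p w h.+1 t l =
   \sum_(l <oo) (renewal_step p (fun j => w t j * m j) l)%:E * tilt p w h t.+1 l)%E.
Proof.
move=> p0 w0 m0.
have t0 h' t' l' := tilt_ge0 h' t' l' p0 w0.
rewrite nneseries_recS; last by move=> i; rewrite mule_ge0 ?lee_fin.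
rewrite /=.
under [in RHS]eq_eseriesr => l _.
  rewrite /renewal_step EFinD ge0_muleDl ?lee_fin ?mulr_ge0//.
  over.
rewrite nneseriesD; [|by move=> i _ _; rewrite mule_ge0 ?lee_fin ?mulr_ge0..].
rewrite addeC; congr (_ + _)%E.
  by apply: eq_eseriesr => i _; rewrite EFinM muleA (muleC (m _)%:E).
under [in RHS]eq_eseriesr => l _ do rewrite EFinM -muleA.
rewrite nneseriesZl; last by move=> i _; rewrite mule_ge0 ?lee_fin ?mulr_ge0.
by rewrite EFinM muleA (muleC (m _)%:E).
Qed.

Lemma renewal_step_ge0 p m : (forall j, 0 <= p j) -> (forall j, 0 <= m j) ->
  forall j, 0 <= renewal_step p m j.
Proof. by move=> p0 m0 j; rewrite addr_ge0 ?mulr_ge0. Qed.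

Lemma renewal_iter_ge0 p m d : (forall j, 0 <= p j) -> (forall j, 0 <= m j) ->
  forall j, 0 <= iter d (renewal_step p) m j.
Proof. by move=> p0 m0; elim: d => //= d IH; exact: renewal_step_ge0. Qed.

Lemma tilt_free p w m h t d : (forall j, 0 <= p j) -> (forall n j, 0 <= w n j) ->
  (forall j, 0 <= m j) ->
  (forall n j, (t <= n < t + d)%N -> w n j = 1) ->
  (\sum_(l <oo) (m l)%:E * tilt p w (d + h) t l =
   \sum_(l <oo) (iter d (renewal_step p) m l)%:E * tilt p w h (t + d) l)%E.
Proof.
move=> p0 w0; elim: d m t => [|d IH] m t m0 w1; first by rewrite addn0.
rewrite addSn tilt_pairing// iterSr addnS -addSn -IH; first last.
- by move=> n j ?; apply: w1; lia.
- exact: renewal_step_ge0.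
apply: eq_eseriesr => l _; congr (_ * _)%E; rewrite /renewal_step.
by rewrite !w1 ?mul1r//; lia.
Qed.

(** The weights met on the deterministic descent from [l] at time [t]. The states visited are [l]
    down to 1; the renewal at time [t + l] is left out. *)
Definition gap_weight w (t l : nat) : K := \prod_(s < l) w (t + s)%N (l - s)%N.

Lemma gap_weight_ge1 w t l : (forall n j, (0 < j)%N -> 1 <= w n j) -> 1 <= gap_weight w t l.
Proof.
move=> w1; rewrite /gap_weight; elim/big_rec: _ => // i x _ x1.
by rewrite -[1]mulr1 ler_pM// w1 //; case: i => i /=; lia.
Qed.

(** After the descent the chain is at 0, where the last hypothesis bounds the rest of the horizon.
    If the horizon ends earlier, the missing weights are at least 1. *)
Lemma tilt_le_gap p w h t l : (forall j, 0 <= p j) ->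
  (forall n j, 0 <= w n j) -> (forall n j, (0 < j)%N -> 1 <= w n j) ->
  (forall h' t', (h' + l <= h)%N -> (tilt p w h' t' 0 <= 1)%E) ->
  (tilt p w h t l <= (gap_weight w t l)%:E)%E.
Proof.
move=> p0 w0 w1; elim: l h t => [|l IH] h t H.
  by rewrite /gap_weight big_ord0; apply: H; rewrite addn0.
case: h H => [|h] H; first by rewrite lee_fin gap_weight_ge1.
rewrite /= /gap_weight big_ord_recl addn0 subn0 EFinM lee_pmul//.
- by rewrite lee_fin.
- exact: tilt_ge0.
apply: le_trans (IH _ _ _) _.
  by move=> h' t' hl; apply: H; rewrite addnS.
rewrite lee_fin /gap_weight le_eqVlt; apply/orP; left; apply/eqP.
by apply: eq_bigr => i _; rewrite /bump /= addnS addSn subSS.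
Qed.

Definition positive_part_mass m (th : nat -> K) :=
  (\sum_(l <oo) (m l * (if l is 0 then 0 else th l))%:E)%E.

(** Decompose at the first time of [F]. Until then the weights are 1 and the mass evolves freely. At
    that time state 0 contributes nothing and a state [l > 0] at most [th l], because the chain is
    back at 0 with a shorter horizon once the gap is over. *)
Lemma tilt_mixture_le1 p w (F : pred nat) (th : nat -> K) m h t :
  (forall j, 0 <= p j) ->
  (forall n j, 0 <= w n j) -> (forall n j, (0 < j)%N -> 1 <= w n j) ->
  (forall n, F n -> w n 0%N = 0) -> (forall n j, ~~ F n -> w n j = 1) ->
  (forall t' l, (0 < l)%N -> gap_weight w t' l <= th l) ->
  (forall j, 0 <= m j) ->
  (forall d, \sum_(l <oo) (iter d (renewal_step p) m l)%:E <= 1)%E ->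
  (forall d, positive_part_mass (iter d (renewal_step p) m) th <= 1)%E ->
  (forall h' t', (h' < h)%N -> (tilt p w h' t' 0 <= 1)%E) ->
  (\sum_(l <oo) (m l)%:E * tilt p w h t l <= 1)%E.
Proof.
move=> p0 w0 w1 wF wNF gth m0 mass pos IH.
have [[d [dh Fd dmin]]|noF] := pselect (exists d, [/\ (d < h)%N, F (t + d)%N &
    forall d', (d' < d)%N -> ~~ F (t + d')%N]); last first.
  have nF d : (d < h)%N -> ~~ F (t + d)%N.
    elim/ltn_ind: d => d dI dh; apply/negP => Fd; apply: noF; exists d.
    by split => // d' d'd; apply: dI => //; apply: ltn_trans dh.
  rewrite -[h in tilt _ _ h]addn0 tilt_free//.
    by apply: le_trans (mass h); apply: lee_nneseries => *;
      rewrite ?mule1// ?mule_ge0// lee_fin renewal_iter_ge0.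
  move=> n j /andP[tn nt]; apply: wNF; rewrite -(subnKC tn); apply: nF; lia.
rewrite -(subnKC (ltnW dh)) tilt_free//; last first.
  move=> n j /andP[tn nt]; apply: wNF; rewrite -(subnKC tn); apply: dmin; lia.
apply: le_trans (pos d); apply: lee_nneseries => l _.
  by rewrite mule_ge0 ?lee_fin ?renewal_iter_ge0// tilt_ge0.
rewrite EFinM lee_wpmul2l ?lee_fin ?renewal_iter_ge0//.
case: l => [|l].
  (* The remaining horizon is positive, so the vanishing weight at state 0 is a factor. *)
  by rewrite -(prednK (_ : 0 < h - d)%N) ?subn_gt0//= wF// mul0e.
apply: le_trans (tilt_le_gap _ _ _ _ _) _ => //; last by rewrite lee_fin gth.
by move=> h' t' hh; apply: IH; lia.
Qed.

Lemma tilt_delta p w h t :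
  (\sum_(l <oo) ((l == 0%N)%:R : K)%:E * tilt p w h t l = tilt p w h t 0)%E.
Proof.
apply/cvg_lim => //; rewrite -(cvg_shiftn 1)/=.
apply: cvg_near_cst; apply: nearW => n; rewrite addn1 big_nat_recl//= mul1e.
by rewrite big1 ?adde0// => i _; rewrite mul0e.
Qed.

Lemma tilt_le1 p w (F : pred nat) (th : nat -> K) :
  (forall j, 0 <= p j) ->
  (forall n j, 0 <= w n j) -> (forall n j, (0 < j)%N -> 1 <= w n j) ->
  (forall n, F n -> w n 0%N = 0) -> (forall n j, ~~ F n -> w n j = 1) ->
  (forall t' l, (0 < l)%N -> gap_weight w t' l <= th l) ->
  let kap d := iter d (renewal_step p) (fun j => (j == 0%N)%:R) in
  (forall d, \sum_(l <oo) (kap d l)%:E <= 1)%E ->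
  (forall d, positive_part_mass (kap d) th <= 1)%E ->
  forall h t, (tilt p w h t 0 <= 1)%E.
Proof.
move=> p0 w0 w1 wF wNF gth kap mass pos; elim/ltn_ind => h IH t.
rewrite -tilt_delta; apply: (@tilt_mixture_le1 p w F th) => // h' t' hh.
exact: IH.
Qed.

Lemma renewal_step_mass p m : (forall j, 0 <= p j) -> (\sum_(j <oo) (p j)%:E = 1)%E ->
  (forall j, 0 <= m j) ->
  (\sum_(l <oo) (renewal_step p m l)%:E = \sum_(l <oo) (m l)%:E)%E.
Proof.
move=> p0 p1 m0; rewrite [RHS]nneseries_recS; last by move=> i; rewrite lee_fin.
rewrite /renewal_step; under eq_eseriesr => l _ do rewrite EFinD EFinM.
rewrite nneseriesD; [|by move=> i _ _; rewrite ?mule_ge0// ?lee_fin..].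
by rewrite nneseriesZl ?p1 ?mule1 1?addeC// => i _; rewrite lee_fin.
Qed.

(** * Bounds on the law of the chain started at 0 *)

Section RenewalBounds.
Variables (p q : nat -> K).
Hypotheses (p0 : forall j, 0 <= p j) (q0 : forall j, 0 <= q j).
Hypotheses (p_gt0 : 0 < p 0%N) (q_gt0 : 0 < q 0%N).
Hypotheses (p1 : (\sum_(j <oo) (p j)%:E = 1)%E) (q1 : (\sum_(j <oo) (q j)%:E = 1)%E).
Hypothesis q_stat : forall j, renewal_step p q j = q j.

(* [kap d] is the law at time [d] of the chain started at 0. *)
Let kap d := iter d (renewal_step p) (fun j => (j == 0%N)%:R).

Lemma kap_ge0 d j : 0 <= kap d j.
Proof. by apply: renewal_iter_ge0 => // i; case: eqP. Qed.

Lemma kap_mass d : (\sum_(l <oo) (kap d l)%:E = 1)%E.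
Proof.
elim: d => [|d IH].
  rewrite /kap /= nneseries_recS; last by move=> [|i]; rewrite lee_fin.
  by rewrite eseries0 ?adde0//=.
by rewrite /kap iterS renewal_step_mass//; exact: kap_ge0.
Qed.

(** The point mass at 0 lies below [q / q 0], and a step of the chain preserves order and fixes
    [q]. *)
Lemma kap_le_stat d j : kap d j <= (q 0%N)^-1 * q j.
Proof.
elim: d j => [|d IH] j.
  by case: j => [|j] /=; rewrite ?mulVf ?gt_eqF// mulr_ge0// invr_ge0 ltW.
rewrite /kap iterS -[q j]q_stat /renewal_step mulrDr lerD ?IH// mulrA ler_wpM2r//.
exact: IH.
Qed.

Lemma kap_shift d i j : kap d (i + j) <= kap (d + i) j.
Proof.
elim: i d => [|i IH] d; first by rewrite addn0.
rewrite addnS -addSn; apply: le_trans (IH _); rewrite /kap iterS /renewal_step.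
by rewrite addSn lerDl mulr_ge0// kap_ge0.
Qed.

(** Drawing the value 0 at [i] successive renewals keeps the chain at 0. *)
Lemma kap_pow d i : p 0%N ^+ i * kap d 0 <= kap (d + i) 0.
Proof.
elim: i => [|i IH]; first by rewrite expr0 mul1r addn0.
rewrite exprS -mulrA addnS /kap iterS /renewal_step mulrC [leRHS]addrC.
rewrite -[leLHS]addr0 lerD ?kap_ge0//; by rewrite ler_wpM2r.
Qed.

(* Tightness: the mass of [kap d] sits in a window [0, J] that does not depend on [d]. *)
Lemma kap0_lower : exists2 de : K, 0 < de & forall d, de <= kap d 0.
Proof.
have : (\sum_(N <= j <oo) (q j)%:E @[N --> \oo] --> 0)%E.
  apply: nneseries_tail_cvg; first by rewrite q1 ltry.
  by move=> j _; rewrite lee_fin.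
move=> /fine_cvgP[finq] /cvgrPdist_lt /(_ (q 0%N / 2)); rewrite divr_gt0// => /(_ isT).
(* By [kap_le_stat], a tail of [q] below [q 0 / 2] leaves [kap d] at most half of its mass beyond
   [J], for every [d]. *)
move=> H; have [J _ {finq H} HJ] :
    \forall N \near \oo, (\sum_(N <= j <oo) (q j)%:E <= (q 0%N / 2)%:E)%E.
  near=> N.
  have fN : (\sum_(N <= j <oo) (q j)%:E)%E \is a fin_num by near: N.
  have : `|0 - fine (\sum_(N <= j <oo) (q j)%:E)%E| < q 0%N / 2 by near: N.
  rewrite sub0r normrN => /ltW; rewrite -[X in (X <= _)%E]fineK// lee_fin.
  exact/le_trans/ler_norm.
have {}HJ := HJ J (leqnn J); rewrite /= in HJ.
have p01 : p 0%N <= 1.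
  rewrite -lee_fin -p1 nneseries_recS; last by move=> ?; rewrite lee_fin.
  by rewrite leeDl// nneseries_ge0// => *; rewrite lee_fin.
have big d : 2^-1 <= \sum_(0 <= j < J) kap d j.
  have /eqP := kap_mass d; rewrite (nneseries_split 0%N J); last first.
    by move=> k _; rewrite lee_fin kap_ge0.
  rewrite add0n => /eqP E.
  have T : (\sum_(J <= k <oo) (kap d k)%:E <= (2^-1)%:E)%E.
    apply: (@le_trans _ _ (\sum_(J <= k <oo) ((q 0%N)^-1)%:E * (q k)%:E)%E).
      apply: lee_nneseries => i *; first by rewrite lee_fin kap_ge0.
      by rewrite -EFinM lee_fin kap_le_stat.
    rewrite nneseriesZl; last by move=> i _; rewrite lee_fin.
    apply: (@le_trans _ _ (((q 0%N)^-1)%:E * (q 0%N / 2)%:E)%E).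
      by apply: lee_wpmul2l => //; rewrite lee_fin invr_ge0 ltW.
    by rewrite -EFinM lee_fin mulrA mulVf ?mul1r// gt_eqF.
  have : (1 <= \sum_(0 <= j < J) (kap d j)%:E + (2^-1)%:E)%E by rewrite -E leeD2l.
  by rewrite sumEFin -EFinD lee_fin -lerBlDr; apply: le_trans; lra.
(* From [j < J], descend for [j] steps and stay at 0 for [J - j] more: the whole window feeds state
   0 at time [d + J]. *)
have step d : p 0%N ^+ J / 2 <= J%:R * kap (d + J)%N 0.
  have : \sum_(0 <= j < J) (p 0%N ^+ J * kap d j) <= \sum_(0 <= j < J) kap (d + J)%N 0.
    rewrite big_seq [leRHS]big_seq; apply: ler_sum => j; rewrite mem_index_iota => /andP[_ jJ].
    apply: (@le_trans _ _ (p 0%N ^+ (J - j) * kap (d + j)%N 0)).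
      apply: ler_pM; rewrite ?exprn_ge0 ?kap_ge0//.
        by apply: ler_wiXn2l => //; rewrite leq_subr.
      by have := kap_shift d j 0; rewrite addn0.
    by have := kap_pow (d + j) (J - j); rewrite -addnA subnKC// ltnW.
  rewrite -mulr_sumr sumr_const_nat subn0 -[in leRHS]mulr_natl; apply: le_trans.
  by rewrite ler_wpM2l ?exprn_ge0.
have pJ : 0 < p 0%N ^+ J by rewrite exprn_gt0.
have J0 : (0 < J)%N.
  case: J {HJ pJ} step big => // _ /(_ 0%N); rewrite big_geq//; lra.
exists (p 0%N ^+ J / (2 * J%:R)); first by rewrite divr_gt0// mulr_gt0// ltr0n.
(* Before time [J] it is enough that the chain has stayed at 0 throughout. *)
move=> d; have [dJ|Jd] := ltnP d J.
  apply: (@le_trans _ _ (p 0%N ^+ d)).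
    apply: (@le_trans _ _ (p 0%N ^+ J)).
      rewrite ler_pdivrMr ?mulr_gt0 ?ltr0n// ler_peMr// ?exprn_ge0//.
      by rewrite -natrM ler1n muln_gt0.
    by apply: ler_wiXn2l => //; rewrite ltnW.
  by have := kap_pow 0 d; rewrite /= mulr1.
rewrite -(subnK Jd) invfM mulrA ler_pdivrMr ?ltr0n// [leRHS]mulrC; exact: step.
Unshelve. all: by end_near. Qed.

Lemma q0_le1 : q 0%N <= 1.
Proof.
rewrite -lee_fin -q1 nneseries_recS; last by move=> ?; rewrite lee_fin.
by rewrite leeDl// nneseries_ge0// => *; rewrite lee_fin.
Qed.

(** The excess of [th] over 1 costs at most [eta * C * M]; the mass at state 0, at least [de], is
    dropped and pays for it. *)
Lemma positive_part_mass_le1 m (psi th : nat -> K) (C M de eta : K) :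
  (forall j, 0 <= m j) -> (forall j, m j <= C * q j) ->
  (\sum_(l <oo) (m l)%:E = 1)%E ->
  (forall j, 0 <= psi j) -> (\sum_(j <oo) (q j * psi j)%:E <= M%:E)%E ->
  (forall j, 0 <= th j <= 1 + eta * psi j) -> 0 <= eta -> 0 <= C ->
  de <= m 0%N -> eta * C * M <= de -> (positive_part_mass m th <= 1)%E.
Proof.
move=> m0 mC m1 psi0 qpsi Hth eta0 C0 dem etade.
have th0 j : 0 <= th j by case/andP: (Hth j).
have pp0 j : 0 <= m j * (if j is 0 then 0 else th j) by case: j => [|j]; rewrite mulr_ge0.
have H : (positive_part_mass m th + (m 0%N)%:E <= 1 + (eta * C * M)%:E)%E.
  apply: (@le_trans _ _ (\sum_(j <oo) ((m j)%:E + (eta * C)%:E * (q j * psi j)%:E))%E).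
    rewrite /positive_part_mass [X in (X + _ <= _)%E]nneseries_recS; last first.
      by move=> ?; rewrite lee_fin pp0.
    rewrite [leRHS]nneseries_recS; last first.
      by move=> ?; rewrite -EFinM -EFinD lee_fin addr_ge0// !mulr_ge0.
    rewrite mulr0 add0e addeC leeD//; first by rewrite leeDl// -EFinM lee_fin !mulr_ge0.
    apply: lee_nneseries => [i _ _|i _]; first by rewrite lee_fin mulr_ge0.
    rewrite -EFinM -EFinD lee_fin.
    have /andP[_ h] := Hth i.+1.
    apply: (le_trans (ler_wpM2l (m0 _) h)); rewrite mulrDr mulr1 lerD2l.
    rewrite mulrA mulrA ler_wpM2r// mulrC -mulrA ler_wpM2l//.
  rewrite nneseriesD; first last.
  - by move=> i _ _; rewrite -EFinM lee_fin !mulr_ge0.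
  - by move=> i _ _; rewrite lee_fin.
  rewrite m1 nneseriesZl; last by move=> i _; rewrite lee_fin mulr_ge0.
  rewrite leeD2l// (EFinM _ M) lee_wpmul2l// lee_fin mulr_ge0//.
have : (positive_part_mass m th + (m 0%N)%:E <= 1 + (m 0%N)%:E)%E.
  by apply: le_trans H _; rewrite leeD2l// lee_fin (le_trans etade).
by rewrite leeD2rE.
Qed.

End RenewalBounds.
End Renewal.

(** * The stretched exponential interarrival law *)

Section Weights.
Context (K : realType).

Definition site_weight (e : K) (i l : nat) : K :=
  if l == 0%N then 0 else if (16 ^ i <= l < 16 ^ i.+1)%N then expR (e * 2 ^+ i) else 1.

(** An entry of [s] is a pair of a time and a scale; one time may occur with several scales. *)
Definition family_weight (e : K) (s : seq (nat * nat)) (n l : nat) : K :=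
  \prod_(f <- s | f.1 == n) site_weight e f.2 l.

Lemma site_weight_ge0 e i l : 0 <= site_weight e i l.
Proof. by rewrite /site_weight; case: ifP => // _; case: ifP => // _; rewrite expR_ge0. Qed.

Lemma site_weight_ge1 e i l : 0 <= e -> (0 < l)%N -> 1 <= site_weight e i l.
Proof.
rewrite /site_weight lt0n => e0 /negbTE ->; case: ifP => // _.
by rewrite -expR0 ler_expR mulr_ge0// exprn_ge0.
Qed.

(** A gap ending at [t + l] matches scale [i] only during its last [16 ^ i.+1] units of time. This
    stretch meets at most two 16-adic intervals of that length, and [s] has at most one entry of
    scale [i] in each. *)
Lemma window_count (s : seq (nat * nat)) (t l i : nat) :
  uniq [seq (f.2, f.1 %/ 16 ^ f.2.+1)%N | f <- s] ->
  (count (fun f => [&& t <= f.1 < t + l, 16 ^ f.2 <= t + l - f.1 < 16 ^ f.2.+1 & f.2 == i]) s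
    <= 2)%N.
Proof.
move=> us; rewrite -size_filter -(size_map (fun f => (f.2, f.1 %/ 16 ^ f.2.+1)%N)).
pose A := ((t + l) %/ 16 ^ i.+1)%N.
apply: (@uniq_leq_size _ _ [:: (i, A); (i, A.-1)]).
  by apply: subseq_uniq us; apply: map_subseq; exact: filter_subseq.
move=> x /mapP[f]; rewrite mem_filter => /andP[/and3P[/andP[tf ft] /andP[_ b] /eqP fi] _] ->.
rewrite fi in b *; rewrite !inE.
have d0 : (0 < 16 ^ i.+1)%N by rewrite expn_gt0.
set D := (16 ^ i.+1)%N in d0 b A *.
have h1 : (f.1 %/ D <= A)%N by rewrite leq_div2r// ltnW.
have h2 : (A <= (f.1 %/ D).+1)%N.
  rewrite -ltnS -(ltn_pmul2r d0) /A; apply: (leq_ltn_trans (leq_divM _ _)).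
  have c := ltn_ceil f.1 d0; apply: (@leq_ltn_trans (f.1 + D)).
    by rewrite -leq_subLR ltnW.
  by rewrite mulSn addnC ltn_add2l; exact: c.
apply/orP; have [->|] := eqVneq (f.1 %/ D)%N A; first by left.
have aux a c : (a <= c)%N -> (c <= a.+1)%N -> a != c -> a = c.-1 by lia.
by move=> ne; right; rewrite (aux _ _ h1 h2 ne).
Qed.

(** The scales that match are at most [trunc_log 16 l], each at most twice; a geometric sum
    remains. *)
Lemma window_sum (s : seq (nat * nat)) (t l : nat) : (0 < l)%N ->
  uniq [seq (f.2, f.1 %/ 16 ^ f.2.+1)%N | f <- s] ->
  (\sum_(f <- s | (t <= f.1 < t + l) && (16 ^ f.2 <= t + l - f.1 < 16 ^ f.2.+1)) 2 ^ f.2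
    <= 4 * 2 ^ trunc_log 16 l)%N.
Proof.
move=> l0 us; set I := trunc_log 16 l.
rewrite (partition_big (fun f => inord f.2 : 'I_I.+1) xpredT)//=.
apply: (@leq_trans (\sum_(i < I.+1) 2 * 2 ^ i)).
  apply: leq_sum => i _.
  rewrite (eq_bigr (fun=> 2 ^ i)%N) => [|f]; last first.
    move=> /andP[/andP[/andP[tf fl] /andP[a b]] /eqP <-]; rewrite inordK// ltnS /I.
    by apply: trunc_log_max => //; apply: leq_trans a _; lia.
  rewrite big_const_seq iter_addn_0 mulnC leq_mul2r; apply/orP; right.
  apply: leq_trans (window_count t l i us); apply: sub_count => f /=.
  move=> /andP[/andP[/andP[tf fl] /andP[a b]] /eqP fi]; rewrite tf fl a b /=.
  rewrite -fi inordK// ltnS /I.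
  by apply: trunc_log_max => //; apply: leq_trans a _; lia.
rewrite -big_distrr/= -(mulnA 2 2) leq_mul2l /=.
have -> : (\sum_(i < I.+1) 2 ^ i = (2 ^ I.+1).-1)%N.
  by rewrite predn_exp mul1n.
by rewrite expnS leq_pred.
Qed.

Definition root4 (j : nat) : K := j%:R `^ (4^-1).

Lemma root4_ge0 j : 0 <= root4 j. Proof. exact: powR_ge0. Qed.

Lemma root4X j : root4 j ^+ 4 = j%:R.
Proof.
by rewrite /root4 -powR_mulrn ?powR_ge0// -powRrM mulVf ?powRr1// pnatr_eq0.
Qed.

(** Here the base 16, which is [2 ^ 4], meets the exponent 1/4 of the interarrival law. *)
Lemma trunc_log_root4 l : (0 < l)%N -> ((2 ^ trunc_log 16 l)%N)%:R <= root4 l.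
Proof.
move=> l0; rewrite -(@ler_pXn2r _ 4)// ?nnegrE ?ler0n ?root4_ge0// root4X.
rewrite -natrX ler_nat -expnM mulnC expnM; exact: trunc_logP.
Qed.

(** Each entry of [s] meets the descent at most once, with residual time [t + l - f.1], so the
    exponents add up to the sum in [window_sum]. *)
Lemma family_gap_weight (e : K) (s : seq (nat * nat)) t l : 0 <= e -> (0 < l)%N ->
  uniq [seq (f.2, f.1 %/ 16 ^ f.2.+1)%N | f <- s] ->
  gap_weight (family_weight e s) t l <= expR (4 * e * root4 l).
Proof.
move=> e0 l0 us; rewrite /gap_weight /family_weight.
rewrite (exchange_big_dep xpredT)//=.
pose P (f : nat * nat) := ((t <= f.1 < t + l) && (16 ^ f.2 <= t + l - f.1 < 16 ^ f.2.+1))%N.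
apply: (@le_trans _ _ (\prod_(f <- s) (if P f then expR (e * 2 ^+ f.2) else 1))).
  apply: ler_prod => f _; rewrite prodr_ge0 => [|*]; last exact: site_weight_ge0.
  rewrite /=; have [/andP[tf fl]|nf] := boolP (t <= f.1 < t + l)%N; last first.
    rewrite big_pred0; last by move=> i; apply: contraNF nf => /eqP ->; have := ltn_ord i; lia.
    by rewrite /P (negbTE nf).
  have fl' : (f.1 - t < l)%N by lia.
  rewrite (big_pred1 (Ordinal fl')) => [|i]; last first.
    by rewrite /= -(inj_eq val_inj)/= -(eqn_add2l t (val i)) subnKC// eq_sym.
  rewrite /P tf fl /= subnBA// addnC /site_weight; case: ifP => // _.
  by case: ifP => // _; rewrite -expR0 ler_expR mulr_ge0// exprn_ge0.
rewrite -big_mkcond/= -expR_sum ler_expR -mulr_sumr (mulrC 4) -mulrA ler_wpM2l//.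
apply: (@le_trans _ _ (4 * (2 ^ trunc_log 16 l)%N%:R)); last first.
  by rewrite ler_wpM2l// trunc_log_root4.
rewrite -natrM; under eq_bigr => f _ do rewrite -natrX.
by rewrite -natr_sum ler_nat window_sum.
Qed.

(** For [x = c * root4 j], the bound [(x / 8) ^+ 8 <= expR x] has a multiple of [j ^ 2] on the left,
    and [j.+1 * j.+2 <= 6 * j ^ 2] when [j > 0]. The summand 2 of the constant serves [j = 0]. *)
Lemma expR_root4_bound (c : K) : 0 < c ->
  exists2 C, 0 < C & forall j, expR (- (c * root4 j)) <= C / (j.+1 * j.+2)%:R.
Proof.
move=> c0; exists (6 * (8 / c) ^+ 8 + 2) => [|j].
  by apply: ltr_wpDl => //; apply: mulr_ge0 => //; rewrite exprn_ge0// divr_ge0// ltW.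
have cc : 0 < (8 / c) ^+ 8 by rewrite exprn_gt0// divr_gt0.
rewrite ler_pdivlMr ?ltr0n//.
case: j => [|j].
  apply: (@le_trans _ _ 2); last by rewrite lerDr mulr_ge0// ltW.
  rewrite ler_piMl//. rewrite -expR0 ler_expR oppr_le0 mulr_ge0 ?root4_ge0// ltW//.
have E : (c / 8) ^+ 8 * (j.+1)%:R ^+ 2 <= expR (c * root4 j.+1).
  have -> : expR (c * root4 j.+1) = expR (c * root4 j.+1 / 8) ^+ 8.
    by rewrite -expRM_natl; congr expR; field.
  have -> : (j.+1)%:R ^+ 2 = root4 j.+1 ^+ 8 by rewrite -root4X -exprM.
  rewrite -exprMn ler_pXn2r// ?nnegrE ?expR_ge0//.
    by apply: le_trans (expR_ge1Dx _); rewrite mulrAC; lra.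
  by rewrite mulr_ge0// ?root4_ge0// divr_ge0// ltW.
rewrite expRN mulrC ler_pdivrMr ?expR_gt0//.
apply: (@le_trans _ _ ((6 * (8 / c) ^+ 8) * expR (c * root4 j.+1))); last first.
  by rewrite ler_wpM2r ?expR_ge0// lerDl.
apply: (@le_trans _ _ ((6 * (8 / c) ^+ 8) * ((c / 8) ^+ 8 * (j.+1)%:R ^+ 2))); last first.
  by rewrite ler_wpM2l// mulr_ge0// ltW.
have -> : 6 * (8 / c) ^+ 8 * ((c / 8) ^+ 8 * (j.+1)%:R ^+ 2) = 6 * (j.+1)%:R ^+ 2 :> K.
  by field; rewrite gt_eqF.
rewrite -natrX -natrM ler_nat; nia.
Qed.

Lemma telescoping_sum n : \sum_(0 <= j < n) ((j.+1 * j.+2)%:R^-1 : K) <= 1.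
Proof.
suff -> : \sum_(0 <= j < n) ((j.+1 * j.+2)%:R^-1 : K) = 1 - n.+1%:R^-1.
  by rewrite lerBlDr lerDl invr_ge0.
elim: n => [|n IH]; first by rewrite big_geq// invr1 subrr.
rewrite big_nat_recr//= IH natrM -[n.+2%:R]natr1; field.
by rewrite nat1r natr1 !pnatr_eq0.
Qed.

Lemma expR_root4_summable (c : K) : 0 < c ->
  exists M : K, (\sum_(j <oo) (expR (- (c * root4 j)))%:E <= M%:E)%E.
Proof.
move=> /expR_root4_bound[C C0 HC]; exists C.
apply: lime_le; first by apply: is_cvg_nneseries => j _ _; rewrite lee_fin expR_ge0.
apply: nearW => n; rewrite sumEFin lee_fin.
apply: (@le_trans _ _ (\sum_(0 <= j < n) C / (j.+1 * j.+2)%:R)).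
  by apply: ler_sum => j _.
by rewrite -mulr_sumr ler_piMr ?telescoping_sum// ltW.
Qed.

(** Summability makes the limit in [K] a genuine one, by comparison with the series whose terms
    before [n] are replaced by 0. *)
Lemma sum_fromE (u : nat -> K) n : (forall j, 0 <= u j) ->
  (\sum_(j <oo) (u j)%:E < +oo)%E -> ((sum_from n u)%:E = \sum_(n <= j <oo) (u j)%:E)%E.
Proof.
move=> u0 us; have us' : (\sum_(n <= j <oo) (u j)%:E < +oo)%E.
  apply: le_lt_trans us; rewrite [leRHS](nneseries_split 0%N n); last first.
    by move=> ? _; rewrite lee_fin.
  by rewrite add0n leeDr// sumEFin lee_fin sumr_ge0.
have cv : cvgn (fun m => \sum_(n <= j < m) u j).
  have := nnseries_is_cvg (u := fun j => if (n <= j)%N then u j else 0).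
  have E : series (fun j => if (n <= j)%N then u j else 0) = (fun m => \sum_(n <= j < m) u j).
    apply/funext => m; rewrite /series/= -big_mkcond/=.
    by rewrite [RHS](big_nat_widenl n 0).
  rewrite E; apply; first by move=> i; case: ifP.
  apply: le_lt_trans us; apply: lee_nneseries => i *; rewrite lee_fin; case: ifP => //.
rewrite /sum_from -EFin_lim//; apply/congr_lim/funext => m /=.
by rewrite sumEFin.
Qed.

Lemma weightE j : weight K j = expR (- root4 j). Proof. by []. Qed.

Lemma weight_gt0 j : 0 < weight K j. Proof. exact: expR_gt0. Qed.

Lemma weight_summable : (\sum_(j <oo) (weight K j)%:E < +oo)%E.
Proof.
have [M HM] := expR_root4_summable ltr01; apply: le_lt_trans (ltry M).
by under eq_eseriesr => j _ do rewrite weightE -[root4 j]mul1r.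
Qed.

Lemma tail_weightE n : ((tail_weight K n)%:E = \sum_(n <= j <oo) (weight K j)%:E)%E.
Proof. by rewrite -sum_fromE// ?weight_summable// => j; rewrite ltW// weight_gt0. Qed.

Lemma tail_weight_rec n : tail_weight K n = weight K n + tail_weight K n.+1.
Proof.
apply: EFin_inj; rewrite EFinD !tail_weightE (nneseries_split n 1); last first.
  by move=> ? _; rewrite lee_fin ltW// weight_gt0.
by rewrite addn1 big_nat1.
Qed.

Lemma tail_weight_ge0 n : 0 <= tail_weight K n.
Proof.
by rewrite -lee_fin tail_weightE nneseries_ge0// => *; rewrite lee_fin ltW// weight_gt0.
Qed.

Lemma ler_root4 i j : (i <= j)%N -> root4 i <= root4 j.
Proof. by move=> ij; rewrite /root4 ge0_ler_powR// ?nnegrE ?ler0n ?invr_ge0// ler_nat. Qed.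

(** For [j >= n], half of the exponent is estimated by its value at [n], and the other half keeps
    the series summable. *)
Lemma tail_weight_le : exists2 C, 0 <= C &
  forall n, tail_weight K n <= C * expR (- (2^-1 * root4 n)).
Proof.
have [M HM] := expR_root4_summable (c := 2^-1) ltac:(by rewrite invr_gt0).
have M0 : 0 <= M.
  rewrite -lee_fin; apply: le_trans HM.
  by apply: nneseries_ge0 => *; rewrite lee_fin expR_ge0.
exists M => // n; rewrite -lee_fin tail_weightE.
apply: (@le_trans _ _ (\sum_(n <= j <oo)
    (expR (- (2^-1 * root4 n)))%:E * (expR (- (2^-1 * root4 j)))%:E)%E).
  rewrite eseries_cond [leRHS]eseries_cond; apply: lee_nneseries => [i _ _|i].
    by rewrite lee_fin expR_ge0.
  move=> /andP[_ /ler_root4 ni].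
  rewrite -EFinM -expRD lee_fin weightE ler_expR; lra.
rewrite nneseriesZl; last by move=> *; rewrite lee_fin expR_ge0.
rewrite (mulrC M) EFinM lee_wpmul2l ?lee_fin ?expR_ge0//.
apply: le_trans HM; rewrite [leRHS](nneseries_split 0%N n); last first.
    by move=> ? _; rewrite lee_fin expR_ge0.
by rewrite add0n leeDr// sumEFin lee_fin sumr_ge0// => *; rewrite expR_ge0.
Qed.

Lemma tail_weight_moment : exists2 M : K, 0 <= M &
  (\sum_(j <oo) (tail_weight K j * expR (4^-1 * root4 j))%:E <= M%:E)%E.
Proof.
have [C C0 HC] := tail_weight_le.
have [M HM] := expR_root4_summable (c := 4^-1) ltac:(by rewrite invr_gt0).
have M0 : 0 <= M.
  rewrite -lee_fin; apply: le_trans HM.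
  by apply: nneseries_ge0 => *; rewrite lee_fin expR_ge0.
exists (C * M); first exact: mulr_ge0.
rewrite EFinM; apply: (@le_trans _ _ (\sum_(j <oo) (C%:E * (expR (- (4^-1 * root4 j)))%:E))%E).
  apply: lee_nneseries => [i _ _|i _].
    by rewrite lee_fin mulr_ge0 ?tail_weight_ge0 ?expR_ge0.
  rewrite -EFinM lee_fin.
  apply: (le_trans (ler_wpM2r (expR_ge0 _) (HC i))).
  rewrite -mulrA ler_wpM2l// -expRD ler_expR; lra.
rewrite nneseriesZl; last by move=> *; rewrite lee_fin expR_ge0.
by rewrite lee_wpmul2l// lee_fin.
Qed.

Lemma tail_weight_summable : (\sum_(j <oo) (tail_weight K j)%:E < +oo)%E.
Proof.
have [M _ HM] := tail_weight_moment; apply: le_lt_trans (ltry M).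
apply: le_trans HM; apply: lee_nneseries => [i _ _|i _]; rewrite lee_fin ?tail_weight_ge0//.
by rewrite ler_peMr ?tail_weight_ge0// -expR0 ler_expR mulr_ge0 ?root4_ge0// invr_ge0.
Qed.

Lemma tail_weight0_gt0 : 0 < tail_weight K 0.
Proof. by rewrite tail_weight_rec ltr_pwDl ?weight_gt0 ?tail_weight_ge0. Qed.

Lemma sum_tail_weight_gt0 : 0 < sum_from 0 (tail_weight K).
Proof.
apply: (lt_le_trans tail_weight0_gt0).
rewrite -lee_fin [leRHS]sum_fromE ?tail_weight_summable//; last exact: tail_weight_ge0.
rewrite nneseries_recS; last by move=> ?; rewrite lee_fin tail_weight_ge0.
by rewrite leeDl// nneseries_ge0// => *; rewrite lee_fin tail_weight_ge0.
Qed.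

Lemma nneseries_normalize (u : nat -> K) : (forall j, 0 <= u j) ->
  (\sum_(j <oo) (u j)%:E < +oo)%E -> 0 < sum_from 0 u ->
  (\sum_(j <oo) (u j / sum_from 0 u)%:E = 1)%E.
Proof.
move=> u0 us s0; under eq_eseriesr => j _ do rewrite mulrC EFinM.
rewrite nneseriesZl => [|i _]; last by rewrite lee_fin.
by rewrite -sum_fromE// -EFinM mulVf// gt_eqF.
Qed.

Lemma sum_weight_gt0 : 0 < sum_from 0 (weight K).
Proof. exact: tail_weight0_gt0. Qed.

Lemma interarrival_gt0 j : 0 < interarrival K j.
Proof. by rewrite /interarrival divr_gt0 ?weight_gt0 ?sum_weight_gt0. Qed.

Lemma interarrival_mass : (\sum_(j <oo) (interarrival K j)%:E = 1)%E.
Proof.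
apply: nneseries_normalize; [|exact: weight_summable|exact: sum_weight_gt0].
by move=> j; rewrite ltW// weight_gt0.
Qed.

Lemma stationary_ge0 j : 0 <= stationary K j.
Proof. by rewrite /stationary divr_ge0 ?tail_weight_ge0// ltW// sum_tail_weight_gt0. Qed.

Lemma stationary0_gt0 : 0 < stationary K 0.
Proof. by rewrite /stationary divr_gt0 ?tail_weight0_gt0 ?sum_tail_weight_gt0. Qed.

Lemma stationary_mass : (\sum_(j <oo) (stationary K j)%:E = 1)%E.
Proof.
by apply: nneseries_normalize; [exact: tail_weight_ge0|exact: tail_weight_summable|
  exact: sum_tail_weight_gt0].
Qed.

(** The normalizer of [interarrival] is [tail_weight K 0], so a renewal adds at [j] exactly the
    difference of two consecutive tails, up to the normalizer of [stationary]. *)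
Lemma stationary_step j :
  renewal_step (interarrival K) (stationary K) j = stationary K j.
Proof.
rewrite /renewal_step /stationary /interarrival [in RHS]tail_weight_rec.
rewrite -[sum_from 0 (weight K)]/(tail_weight K 0).
by field; rewrite !gt_eqF ?tail_weight0_gt0 ?sum_tail_weight_gt0.
Qed.

Lemma stationary_moment : exists2 M : K, 0 <= M &
  (\sum_(j <oo) (stationary K j * expR (4^-1 * root4 j))%:E <= M%:E)%E.
Proof.
have [M M0 HM] := tail_weight_moment.
have s0 := sum_tail_weight_gt0.
exists ((sum_from 0 (tail_weight K))^-1 * M); first by rewrite mulr_ge0// invr_ge0 ltW.
rewrite /stationary; under eq_eseriesr => j _ do rewrite mulrAC mulrC EFinM.
rewrite nneseriesZl => [|i _]; last by rewrite lee_fin mulr_ge0 ?tail_weight_ge0 ?expR_ge0.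
by rewrite EFinM lee_wpmul2l// lee_fin invr_ge0 ltW.
Qed.

(** Convexity of the exponential between 0 and [x], derived from the tangent at [eta * x]. *)
Lemma expR_chord (eta x : K) : 0 <= eta <= 1 ->
  expR (eta * x) <= 1 + eta * expR x.
Proof.
move=> /andP[e0 e1].
suff : expR (eta * x) <= eta * expR x + (1 - eta) by lra.
have E y : expR (eta * x) * (1 + (y - eta * x)) <= expR y.
  have -> : expR y = expR (eta * x) * expR (y - eta * x) by rewrite -expRD; congr expR; ring.
  by rewrite ler_wpM2l ?expR_ge0 ?expR_ge1Dx.
have := ler_wpM2l e0 (E x); have := E 0; rewrite expR0 => h1 h2.
have h3 : (1 - eta) * (expR (eta * x) * (1 + (0 - eta * x))) <= 1 - eta.
  by rewrite -[leRHS]mulr1 ler_wpM2l// subr_ge0.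
apply: le_trans (lerD h2 h3); rewrite le_eqVlt; apply/orP; left; apply/eqP; ring.
Qed.

(* The gap straddling the first time of [s] is closed with conditional probability
   at most [1 - de]; for small [e] this absorbs the tilt, whose excess over [1] is
   of order [e]. *)
Lemma family_tilt_le1 : exists2 e : K, 0 < e & forall (s : seq (nat * nat)) h,
  uniq [seq (f.2, f.1 %/ 16 ^ f.2.+1)%N | f <- s] ->
  (\sum_(l <oo) (stationary K l)%:E *
     tilt (interarrival K) (family_weight e s) h 0 l <= 1)%E.
Proof.
have p0 j : 0 <= interarrival K j by rewrite ltW// interarrival_gt0.
have q0 := stationary_ge0.
have pg := interarrival_gt0 0; have qg := stationary0_gt0.
have [de de0 Hde] := kap0_lower p0 q0 pg qg interarrival_mass stationary_mass stationary_step.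
have [M M0 HM] := stationary_moment.
set q := stationary K in q0 qg Hde HM *; set p := interarrival K in p0 pg Hde *.
pose C := (q 0%N)^-1.
have q01 : q 0%N <= 1 by exact: q0_le1 stationary_mass.
have C1 : 1 <= C by rewrite /C invf_ge1.
have C0 : 0 <= C by apply: le_trans C1.
(* A lower bound for the mass at 0 under both kinds of start: after a renewal, and from the
   stationary law. *)
pose d' := Num.min de (q 0%N).
have d'0 : 0 < d' by rewrite lt_min de0 qg.
pose eta := Num.min 1 (d' / (C * M + 1)).
have CM : 0 < C * M + 1 by rewrite ltr_wpDl// mulr_ge0.
have eta0 : 0 < eta by rewrite lt_min ltr01 divr_gt0.
have eta1 : 0 <= eta <= 1 by rewrite ltW//= ge_min lexx.
have etaCM : eta * C * M <= d'.
  have : eta <= d' / (C * M + 1) by rewrite ge_min lexx orbT.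
  rewrite ler_pdivlMr// -mulrA mulrDr mulr1; apply: le_trans.
  by rewrite lerDl ltW.
(* With [e = eta / 16] the gap bound is [expR (eta * (4^-1 * root4 l))], and [expR_chord] turns it
   into [1 + eta * psi l], whose moment is known. *)
exists (eta / 16); first by rewrite divr_gt0.
move=> s h us.
pose th j := expR (4 * (eta / 16) * root4 j).
have e0 : 0 <= eta / 16 by rewrite ltW// divr_gt0.
pose psi j := expR (4^-1 * root4 j).
have Hth j : 0 <= th j <= 1 + eta * psi j.
  rewrite expR_ge0/= /th /psi; have -> : 4 * (eta / 16) * root4 j = eta * (4^-1 * root4 j) by field.
  exact: expR_chord.
have w0 n j : 0 <= family_weight (eta / 16) s n j.
  by apply: prodr_ge0 => *; exact: site_weight_ge0.
have w1 n j : (0 < j)%N -> 1 <= family_weight (eta / 16) s n j.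
  move=> j0; rewrite /family_weight; elim/big_rec: _ => // f x _ x1.
  by apply: mulr_ege1 => //; exact: site_weight_ge1.
pose F n := n \in [seq f.1 | f <- s].
have wF n : F n -> family_weight (eta / 16) s n 0 = 0.
  move=> /mapP[f fs ->]; rewrite /family_weight (big_rem f)//= eqxx.
  by rewrite /site_weight mul0r.
have wNF n j : ~~ F n -> family_weight (eta / 16) s n j = 1.
  move=> nF; rewrite /family_weight big_seq_cond big_pred0// => f.
  by apply: contraNF nF => /andP[fs /eqP <-]; apply: map_f.
have gth t l : (0 < l)%N -> gap_weight (family_weight (eta / 16) s) t l <= th l.
  by move=> l0; exact: family_gap_weight.
have psi0 j : 0 <= psi j by exact: expR_ge0.
have q_iter d : iter d (renewal_step p) q = q.
  by elim: d => //= d ->; apply/funext => j; exact: stationary_step.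
have kg : forall h t, (tilt p (family_weight (eta / 16) s) h t 0 <= 1)%E.
  apply: (tilt_le1 (F := F) (th := th)) => // d.
    by rewrite kap_mass// interarrival_mass.
  apply: (@positive_part_mass_le1 _ q _ _ psi th C M de eta) => //.
  + exact: kap_ge0.
  + by move=> j; apply: (kap_le_stat p0 q0 qg stationary_step).
  + by rewrite kap_mass// interarrival_mass.
  + exact: ltW.
  + by apply: le_trans etaCM _; rewrite ge_min lexx.
apply: (@tilt_mixture_le1 _ p _ F th) => //.
- by move=> d; rewrite q_iter stationary_mass.
- move=> d; rewrite q_iter.
  apply: (@positive_part_mass_le1 _ q _ _ psi th C M (q 0%N) eta) => //.
  + by move=> j; rewrite ler_peMl.
  + exact: stationary_mass.
  + exact: ltW.
  + by apply: le_trans etaCM _; rewrite ge_min lexx orbT.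
Qed.

End Weights.

(** * Expectations along the chain *)

Section Chain.
Context (K : realType) (d : measure_display) (T : measurableType d) (P : probability T K).

Lemma measurable_EFin_fun (f : T -> K) : measurable_fun setT f ->
  measurable_fun setT (fun x => (f x)%:E : \bar K).
Proof. by move=> mf; apply/measurable_EFinP. Qed.

Lemma measurable_nat_fun (X : {RV P >-> nat}) (f : nat -> K) :
  measurable_fun setT (fun x => f (X x)).
Proof. by apply: (measurableT_comp (f := f)) => //; exact: measurable_funPT. Qed.

Lemma measurable_nat_event (X : {RV P >-> nat}) (A : set nat) : measurable [set x | A (X x)].
Proof. exact: (measurable_funPTI X). Qed.

Lemma nneseries_single (f : nat -> \bar K) b : (forall k, (0 <= f k)%E) ->
  (forall k, k != b -> f k = 0%E) -> (\sum_(k <oo) f k = f b)%E.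
Proof.
move=> f0 fb; rewrite (@nneseriesD1 _ f b)// eseries0 ?adde0// => i _ /= ib.
exact: fb.
Qed.

Lemma integral_split (X : {RV P >-> nat}) (f : T -> K) :
  measurable_fun setT f -> (forall x, 0 <= f x) ->
  (\int[P]_x (f x)%:E = \sum_(v <oo) \int[P]_x (f x * (X x == v)%:R)%:E)%E.
Proof.
move=> mf f0; rewrite -integral_nneseries//.
- apply: eq_integral => x _; rewrite (nneseries_single (b := X x)) ?eqxx ?mulr1//.
    by move=> k; rewrite lee_fin mulr_ge0.
  by move=> k kX; rewrite eq_sym (negbTE kX) mulr0.
- move=> n; apply: measurable_EFin_fun; apply: measurable_funM => //.
  exact: (measurable_nat_fun X (fun k => (k == n)%:R)).
- by move=> n x _; rewrite lee_fin mulr_ge0.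
Qed.

Variables (init p : nat -> K) (X : nat -> {RV P >-> nat}).
Hypotheses (init0 : forall j, 0 <= init j) (p0 : forall j, 0 <= p j).
Hypothesis markov : is_markov_chain init (renewal_trans p) X.
Variable w : nat -> nat -> K.
Hypothesis w0 : forall n j, 0 <= w n j.

Let path_weight j x := \prod_(i < j) w i (X i x).
Let tail_event n j (a : nat -> nat) : set T :=
  [set x | forall i, (j <= i)%N -> (i <= n)%N -> X i x = a i].

Let path_weight_ge0 j x : 0 <= path_weight j x.
Proof. by apply: prodr_ge0. Qed.

Let measurable_path_weight j : measurable_fun setT (path_weight j).
Proof. by apply: measurable_prod => i _; exact: measurable_nat_fun. Qed.

Let measurable_tail_event n j a : measurable (tail_event n j a).
Proof.
have -> : tail_event n j a =
    \bigcap_(i in [set i | (j <= i)%N /\ (i <= n)%N]) [set x | X i x = a i].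
  by apply/seteqP; split=> x h i; [case=> ji ni; exact: h|move=> ji ni; apply: h].
by apply: bigcap_measurableType => i _; exact: (measurable_nat_event (X i) [set a i]).
Qed.

Lemma renewal_trans_ge0 l b : 0 <= renewal_trans p l b.
Proof. by rewrite /renewal_trans; case: ifP => // _; case: eqP. Qed.

(** The Markov property is given for complete histories. Induction on [j] frees the first [j]
    states: splitting over the value [v] of [X j] gives the factor [w j v] and a history [a'] pinned
    from time [j] on. *)
Let markov_aux n j a b : (j <= n)%N ->
  (\int[P]_x (path_weight j x * \1_(tail_event n j a) x * (X n.+1 x == b)%:R)%:E =
   (renewal_trans p (a n) b)%:E * \int[P]_x (path_weight j x * \1_(tail_event n j a) x)%:E)%E.
Proof.
have mi j' a' : measurable_fun setT (\1_(tail_event n j' a') : T -> K).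
  exact: measurable_indic.
have mX i v : measurable_fun setT (fun x => (X i x == v)%:R : K).
  exact: (measurable_nat_fun (X i) (fun k => (k == v)%:R)).
elim: j a => [|j IH] a jn.
  have [_ /(_ n a b) M] := markov.
  have E0 : tail_event n 0 a = [set x | forall i, (i <= n)%N -> X i x = a i].
    by apply/seteqP; split => x h i => [ni|_ ni]; apply: h.
  have m2 : measurable [set x | X n.+1 x = b] by exact: (measurable_nat_event _ [set b]).
  have m0 := measurable_tail_event n 0 a.
  under eq_integral => x _ do rewrite /path_weight big_ord0 mul1r.
  under [in RHS]eq_integral => x _ do rewrite /path_weight big_ord0 mul1r.
  rewrite integral_indic// setIT E0 muleC -M.
  transitivity (\int[P]_x (\1_([set x | forall i, (i <= n)%N -> X i x = a i] `&`
      [set x | X n.+1 x = b]) x)%:E)%E.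
    apply: eq_integral => x _; rewrite indicI; congr (_ * _)%:E.
    by rewrite indicE; congr (_%:R); congr nat_of_bool; apply/eqP/idP; rewrite inE.
  rewrite integral_indic// ?setIT//; apply: measurableI => //.
  by rewrite -E0.
have nn f x : 0 <= f x -> 0 <= f x * \1_(tail_event n j.+1 a) x :> K.
  by move=> ?; rewrite mulr_ge0.
rewrite (integral_split (X j)); first last.
- by move=> x; rewrite !mulr_ge0.
- by apply: measurable_funM => //; apply: measurable_funM.
rewrite [in RHS](integral_split (X j)); first last.
- by move=> x; rewrite !mulr_ge0.
- by apply: measurable_funM.
rewrite -nneseriesZl; last by move=> v _; apply: integral_ge0 => x _; rewrite lee_fin !mulr_ge0.
apply: eq_eseriesr => v _.
pose a' i := if i == j then v else a i.
have a'n : a' n = a n by rewrite /a' gtn_eqF.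
have E x : path_weight j.+1 x * \1_(tail_event n j.+1 a) x * (X j x == v)%:R =
           w j v * (path_weight j x * \1_(tail_event n j a') x).
  rewrite /path_weight big_ord_recr/= !indicE.
  have [Xv|Xv] := eqVneq (X j x) v; last first.
    rewrite mulr0 (_ : x \in tail_event n j a' = false) ?mulr0//.
    apply/negbTE/negP; rewrite inE => /(_ j (leqnn _) (ltnW jn)); rewrite /a' eqxx.
    by apply/eqP.
  rewrite (_ : x \in tail_event n j a' = (x \in tail_event n j.+1 a)).
    by rewrite Xv mulr1 mulrAC mulrC.
  apply/idP/idP; rewrite !inE => h i ji ni.
    by rewrite h ?(ltnW ji)// /a' gtn_eqF.
  rewrite /a'; case: eqVneq => [->//|ij]; apply: h => //.
  by rewrite ltn_neqAle eq_sym ij.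
under eq_integral => x _ do rewrite mulrAC E -mulrA EFinM.
under [in RHS]eq_integral => x _ do rewrite E EFinM.
have mf : measurable_fun setT (fun x => path_weight j x * \1_(tail_event n j a') x).
  exact: measurable_funM.
rewrite ge0_integralZl ?lee_fin//; first last.
- by move=> x _; rewrite lee_fin !mulr_ge0.
- by apply: measurable_EFin_fun; apply: measurable_funM.
rewrite ge0_integralZl ?lee_fin//; first last.
- by move=> x _; rewrite lee_fin !mulr_ge0.
- exact: measurable_EFin_fun.
by rewrite IH ?(ltnW jn)// a'n muleCA.
Qed.

(** The law of [X n] tilted by the weights at times before [n], not normalized. *)
Fixpoint forward_mass n : nat -> K :=
  if n is n'.+1 then renewal_step p (fun j => w n' j * forward_mass n' j) else init.

Lemma forward_mass_ge0 n j : 0 <= forward_mass n j.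
Proof.
elim: n j => //= n IH j; apply: renewal_step_ge0 => // i; exact: mulr_ge0.
Qed.

Let path_weight_state n l :
  (\int[P]_x (path_weight n x * (X n x == l)%:R)%:E = (forward_mass n l)%:E)%E.
Proof.
have mX i v : measurable_fun setT (fun x => (X i x == v)%:R : K).
  exact: (measurable_nat_fun (X i) (fun k => (k == v)%:R)).
elim: n l => [|n IH] l.
  have [<- _] := markov.
  under eq_integral => x _ do rewrite /path_weight big_ord0 mul1r.
  rewrite -[in RHS](setIT [set w | _]) -integral_indic//; last first.
    exact: (measurable_nat_event _ [set l]).
  apply: eq_integral => x _; rewrite indicE; congr (_%:R%:E); congr nat_of_bool.
  by apply/eqP/idP; rewrite inE.
rewrite (integral_split (X n)); first last.
- by move=> x; rewrite mulr_ge0.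
- exact: measurable_funM.
have S v : (\int[P]_x (path_weight n.+1 x * (X n.+1 x == l)%:R * (X n x == v)%:R)%:E =
    (w n v * renewal_trans p v l * forward_mass n v)%:E)%E.
  have E x : tail_event n n (fun=> v) x <-> X n x = v.
    split=> [|Xv i ni ne]; first by apply.
    by have -> : i = n by apply/eqP; rewrite eqn_leq ne.
  have E1 x : (X n x == v)%:R = \1_(tail_event n n (fun=> v)) x :> K.
    rewrite indicE; congr (_%:R); congr nat_of_bool.
    by apply/eqP/idP; rewrite inE => /E.
  rewrite -mulrA EFinM EFinM -IH.
  under [in RHS]eq_integral => x _ do rewrite E1.
  rewrite -markov_aux// -ge0_integralZl ?lee_fin ?renewal_trans_ge0//; first last.
  - by move=> x _; rewrite lee_fin !mulr_ge0.
  - apply: measurable_EFin_fun; apply: measurable_funM => //; apply: measurable_funM => //.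
  apply: eq_integral => x _; rewrite -EFinM -E1; congr EFin.
  rewrite /path_weight big_ord_recr/=.
  by case: (eqVneq (X n x) v) => [->|_]; rewrite ?mulr0 ?mulr1 ?mul0r //; ring.
under eq_eseriesr => v _ do rewrite S.
(* A step into [l] comes from 0 or from [l.+1]: only these two terms of the series survive. *)
rewrite nneseries_recS; last first.
  by move=> v; rewrite lee_fin !mulr_ge0 ?forward_mass_ge0 ?renewal_trans_ge0.
rewrite (nneseries_single (b := l)); first last.
- move=> k kl; rewrite /renewal_trans /= eq_sym (negbTE kl) mulr0 mul0r//.
- by move=> v; rewrite lee_fin !mulr_ge0 ?forward_mass_ge0 ?renewal_trans_ge0.
rewrite -EFinD; congr EFin; rewrite /renewal_trans /= eqxx mulr1 /renewal_step addrC mulrAC //.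
Qed.

(** The pairing of [forward_mass k] with the tilt over the remaining [n - k] times does not depend
    on [k]; compare [k = 0] with [k = n]. *)
Lemma path_weight_expectation n :
  (\int[P]_x (path_weight n x)%:E = \sum_(l <oo) (init l)%:E * tilt p w n 0 l)%E.
Proof.
transitivity (\sum_(l <oo) (forward_mass n l)%:E)%E.
  rewrite (integral_split (X n))//.
  by apply: eq_eseriesr => l _; exact: path_weight_state.
have H k : (k <= n)%N -> (\sum_(l <oo) (init l)%:E * tilt p w n 0 l =
    \sum_(l <oo) (forward_mass k l)%:E * tilt p w (n - k) k l)%E.
  elim: k => [|k IH] kn; first by rewrite subn0.
  rewrite IH ?(ltnW kn)// -(subnSK kn) tilt_pairing//; exact: forward_mass_ge0.
rewrite (H n)// subnn; apply: eq_eseriesr => l _ /=; by rewrite mule1.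
Qed.

End Chain.

(** The constant [e] comes before the probability space, because [R0] will be computed from it. *)
Lemma family_expectation_le1 (K : realType) : exists2 e : K, 0 < e &
  forall (d : measure_display) (T : measurableType d) (P : probability T K)
    (X : nat -> {RV P >-> nat}) (s : seq (nat * nat)),
  is_markov_chain (stationary K) (renewal_trans (interarrival K)) X ->
  uniq [seq (f.2, f.1 %/ 16 ^ f.2.+1)%N | f <- s] ->
  (\int[P]_x (\prod_(f <- s) site_weight e f.2 (X f.1 x))%:E <= 1)%E.
Proof.
have [e e0 He] := family_tilt_le1 K; exists e => // d T P X s mX us.
(* This horizon lies beyond all times of [s], so every entry is counted. *)
pose h := (\max_(f <- s) f.1).+1.
have fh f : f \in s -> (f.1 < h)%N.
  by move=> fs; rewrite /h ltnS (big_rem f)//= leq_maxl.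
apply: le_trans (He s h us).
rewrite -(path_weight_expectation _ _ mX) => [|||n j]; first last.
- by apply: prodr_ge0 => *; exact: site_weight_ge0.
- by move=> j; rewrite ltW// interarrival_gt0.
- exact: stationary_ge0.
rewrite le_eqVlt; apply/orP; left; apply/eqP; apply: eq_integral => x _; congr EFin.
rewrite /family_weight (exchange_big_dep xpredT)//= big_seq [RHS]big_seq.
apply: eq_bigr => f fs; rewrite (big_pred1 (Ordinal (fh f fs))) //=.
Qed.

(** * Independence *)

Section SimpleFunctions.
Context (K : realType) (d : measure_display) (T : measurableType d) (P : probability T K).
Implicit Types (G : set (set T)) (f g : T -> K).

(** Site weights take three values, so finite combinations of events suffice, and independence of
    events passes to them by expansion. *)
Definition simple_for G f := exists (J : finType) (c : J -> K) (D : J -> set T),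
  (forall k, 0 <= c k /\ G (D k)) /\ forall w, f w = \sum_k c k * \1_(D k) w.

Lemma simple_for_cst G c : G setT -> 0 <= c -> simple_for G (fun=> c).
Proof.
move=> GT c0; exists unit, (fun=> c), (fun=> setT); split=> // w.
by rewrite (big_pred1 tt) => [|[]//]; rewrite indicT mulr1.
Qed.

Lemma simple_forM G f g : (forall A B, G A -> G B -> G (A `&` B)) ->
  simple_for G f -> simple_for G g -> simple_for G (fun w => f w * g w).
Proof.
move=> GI [J [c [D [H Hf]]]] [J' [c' [D' [H' Hg]]]].
exists (J * J')%type, (fun k => c k.1 * c' k.2), (fun k => D k.1 `&` D' k.2); split.
  move=> k; have [? ?] := H k.1; have [? ?] := H' k.2.
  by split; [exact: mulr_ge0|exact: GI].
move=> w; rewrite Hf Hg big_distrlr pair_big; apply: eq_bigr => k _ /=.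
by rewrite indicI mulrACA.
Qed.

Lemma simple_for_prod G (I : Type) (s : seq I) (h : I -> T -> K) : G setT ->
  (forall A B, G A -> G B -> G (A `&` B)) ->
  (forall i, simple_for G (h i)) -> simple_for G (fun w => \prod_(i <- s) h i w).
Proof.
move=> GT GI Hh; elim: s => [|i s IH].
  under eq_fun do rewrite big_nil; exact: simple_for_cst.
under eq_fun do rewrite big_cons; exact: simple_forM.
Qed.

Lemma simple_for_measurable G f : G `<=` measurable -> simple_for G f ->
  measurable_fun setT f.
Proof.
move=> Gm [J [c [D [H Hf]]]]; rewrite (_ : f = fun w => \sum_k c k * \1_(D k) w); last exact/funext.
apply: measurable_sum => k; apply: measurable_funM => //.
by apply: measurable_indic; apply: Gm; case: (H k).
Qed.

Lemma simple_for_ge0 G f w : simple_for G f -> 0 <= f w.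
Proof.
by move=> [J [c [D [H ->]]]]; apply: sumr_ge0 => k _; rewrite mulr_ge0//; case: (H k).
Qed.

Lemma prod_indic (I : eqType) (ys : seq I) (A : I -> set T) w :
  \prod_(y <- ys) \1_(A y) w = \1_(\big[setI/setT]_(y <- ys) A y) w :> K.
Proof.
elim: ys => [|y ys IH]; first by rewrite !big_nil indicT.
by rewrite !big_cons indicI IH.
Qed.

Lemma simple_for_integral G f (J : finType) (c : J -> K) (D : J -> set T) :
  G `<=` measurable -> (forall k, 0 <= c k /\ G (D k)) ->
  (forall w, f w = \sum_k c k * \1_(D k) w) ->
  (\int[P]_w (f w)%:E = \sum_k (c k)%:E * P (D k))%E.
Proof.
move=> Gm H Hf; under eq_integral => w _ do rewrite Hf -sumEFin.
have mD k : measurable_fun setT (fun w => (\1_(D k) w : K)%:E).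
  by apply: measurable_EFin_fun; apply: measurable_indic; apply: Gm; case: (H k).
rewrite ge0_integral_sum//; first last.
- by move=> k w _; rewrite lee_fin mulr_ge0//; case: (H k).
- move=> k; apply: measurable_EFin_fun; apply: measurable_funM => //.
  by apply: measurable_indic; apply: Gm; case: (H k).
apply: eq_bigr => k _; under eq_integral => w _ do rewrite EFinM.
rewrite ge0_integralZl//; last by rewrite lee_fin; case: (H k).
by rewrite integral_indic ?setIT//; apply: Gm; case: (H k).
Qed.

(** Induction on [xs]: expanding [Z x] into indicators moves the index [x] into [ys], with the event
    [D k]. When [xs] is empty, the claim is the independence of events. *)
Lemma independent_expectation (I : choiceType) (F : I -> set (set T)) (Z : I -> T -> K) :
  (forall i, F i `<=` measurable) -> mutually_independent P F ->
  (forall i, simple_for (F i) (Z i)) ->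
  forall (xs ys : seq I) (A : I -> set T), uniq (xs ++ ys) ->
  (forall y, y \in ys -> F y (A y)) ->
  (\int[P]_w (\prod_(x <- xs) Z x w * \prod_(y <- ys) \1_(A y) w)%:E =
   \prod_(x <- xs) \int[P]_w (Z x w)%:E * \prod_(y <- ys) P (A y))%E.
Proof.
move=> Fm indep HZ xs; elim: xs => [|x xs IH] ys A.
  move=> /= us HA; rewrite big_nil mul1e.
  under eq_integral => w _ do rewrite big_nil mul1r prod_indic.
  have mA : measurable (\big[setI/setT]_(y <- ys) A y).
    by rewrite big_seq; apply: bigsetI_measurable => y /HA; exact: Fm.
  rewrite integral_indic// setIT -bigcap_seq.
  pose J := [fset y in ys]%fset.
  have JE : J =i ys by move=> y; rewrite in_fset.
  have -> : [set` ys] = [set` J] by apply/seteqP; split => y /=; rewrite JE.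
  transitivity (\prod_(y <- J) P (A y))%E.
    by apply: indep => y; rewrite JE; exact: HA.
  by apply: perm_big; apply: uniq_perm => //; exact: fset_uniq.
rewrite cat_cons cons_uniq => /andP[xn us] HA.
have [J [c [D [H HD]]]] := HZ x.
pose A' k y := if y == x then D k else A y.
have us' : uniq (xs ++ x :: ys).
  by rewrite (perm_uniq (permEl (perm_catCA xs [:: x] ys))) /= xn.
have xys : x \notin ys by move: xn; rewrite mem_cat negb_or => /andP[].
have mZ i : measurable_fun setT (Z i) by exact: simple_for_measurable (Fm i) (HZ i).
have Z0 i w : 0 <= Z i w by exact: simple_for_ge0 (HZ i).
have mprod k : measurable_fun setT
    (fun w => \prod_(i <- xs) Z i w * \prod_(y <- x :: ys) \1_(A' k y) w).
  apply: measurable_funM; apply: measurable_prod => i iy //.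
  apply: measurable_indic; rewrite /A'; case: eqVneq iy => [-> _|ix].
    by apply: (Fm x); case: (H k).
  by rewrite inE (negbTE ix) => /HA; exact: Fm.
have prod0 k w : 0 <= \prod_(i <- xs) Z i w * \prod_(y <- x :: ys) \1_(A' k y) w.
  by rewrite mulr_ge0// prodr_ge0.
have A'E (R : Type) (idx : R) (op : Monoid.law idx) (h : set T -> R) k :
    \big[op/idx]_(y <- x :: ys) h (A' k y) = op (h (D k)) (\big[op/idx]_(y <- ys) h (A y)).
  rewrite big_cons {1}/A' eqxx big_seq [in RHS]big_seq; congr (op _ _).
  by apply: eq_bigr => y yy; rewrite /A'; case: eqVneq => // yx; rewrite -yx yy in xys.
transitivity (\sum_k (c k)%:E * \int[P]_w
   (\prod_(i <- xs) Z i w * \prod_(y <- x :: ys) \1_(A' k y) w)%:E)%E.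
  under eq_bigr => k _.
    rewrite -ge0_integralZl//; first last.
    - by rewrite lee_fin; case: (H k).
    - by move=> w _; rewrite lee_fin.
    - exact: measurable_EFin_fun.
    over.
  rewrite -ge0_integral_sum//; first last.
  - by move=> k w _; rewrite -EFinM lee_fin mulr_ge0//; case: (H k).
  - by move=> k; apply: (measurable_EFin_fun (f := fun w => c k * _)); exact: measurable_funM.
  apply: eq_integral => w _; rewrite big_cons HD.
  rewrite !mulr_suml -sumEFin; apply: eq_bigr => k _.
  rewrite -EFinM (A'E _ _ _ (fun B => \1_B w)) /=; congr EFin.
  by rewrite -!mulrA; congr (_ * _); rewrite mulrCA.
under eq_bigr => k _.
  rewrite (IH _ _ us') => [|y]; last first.
    by rewrite inE /A'; case: eqVneq => [-> _|_ /HA//]; case: (H k).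
  rewrite (A'E _ _ _ (fun B => P B)) /= muleCA muleA.
  over.
have P0 : (0 <= \prod_(i <- xs) (\int[P]_w (Z i w)%:E) * \prod_(y <- ys) P (A y))%E.
  by apply: mule_ge0; apply: prode_ge0 => i _ //; apply: integral_ge0 => w _; rewrite lee_fin.
rewrite big_cons (simple_for_integral (Fm x) H HD) -muleA ge0_sume_distrl; last first.
  by move=> k _; rewrite mule_ge0// lee_fin; case: (H k).
by apply: eq_bigr => k _; rewrite -!muleA muleCA; congr (_ * _)%E; rewrite muleCA.
Qed.

End SimpleFunctions.

(** * Bad sites and their joint probability *)

Section BadSites.
Context (K : realType) (d : measure_display) (T : measurableType d) (P : probability T K).

Lemma process_measurable (X : nat -> {RV P >-> nat}) : process_sigma_algebra X `<=` measurable.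
Proof.
apply: smallest_sub; first exact: sigma_algebra_measurable.
move=> A [n _ [B _ <-]]; rewrite setTI; exact: measurable_funPTI.
Qed.

Lemma process_setT (X : nat -> {RV P >-> nat}) : process_sigma_algebra X setT.
Proof.
exact: (@measurableT _ (g_sigma_algebraType
  (\bigcup_n preimage_set_system setT (X n) measurable))).
Qed.

Lemma process_setI (X : nat -> {RV P >-> nat}) A B :
  process_sigma_algebra X A -> process_sigma_algebra X B ->
  process_sigma_algebra X (A `&` B).
Proof.
exact: (@measurableI _ (g_sigma_algebraType
  (\bigcup_n preimage_set_system setT (X n) measurable))).
Qed.

Lemma process_event (X : nat -> {RV P >-> nat}) n (B : set nat) :
  process_sigma_algebra X [set w | B (X n w)].
Proof.
by apply: sub_gen_smallest; exists n => //; exists B => //; rewrite setTI.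
Qed.

Lemma site_weight_simple (X : nat -> {RV P >-> nat}) (e : K) n i :
  simple_for (process_sigma_algebra X) (fun w => site_weight e i (X n w)).
Proof.
pose cl l := (16 ^ i <= l < 16 ^ i.+1)%N.
exists bool, (fun b => if b then expR (e * 2 ^+ i) else 1),
  (fun b : bool => [set w | (0 < X n w)%N && (cl (X n w) == b)]); split.
  move=> b; split; first by case: b => //; rewrite expR_ge0.
  exact: (@process_event X n [set l | (0 < l)%N && (cl l == b)]).
move=> w; rewrite big_bool /site_weight.
have E b : \1_[set w | (0 < X n w)%N && (cl (X n w) == b)] w =
    ((X n w != 0%N) && (cl (X n w) == b))%:R :> K.
  by rewrite indicE -lt0n; congr (nat_of_bool _)%:R; apply/idP/idP; rewrite inE.
rewrite !E.
case: eqVneq => [->|_] /=; first by rewrite !mulr0 addr0.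
by rewrite -/(cl _); case: (cl _); rewrite /= ?mulr1 ?mulr0 ?addr0 ?add0r.
Qed.

Variables (N : int -> nat -> {RV P >-> nat}) (B : nat).
Hypothesis HN : renewal_family N.
Hypothesis B0 : (0 < B)%N.

Definition column (k : int) (j : nat) : int := k * B%:Z + j%:Z.

Lemma column_inj k k' j j' : (j < B)%N -> (j' < B)%N ->
  column k j = column k' j' -> k = k' /\ j = j'.
Proof.
rewrite /column => jB jB' E.
have h x : (x < B)%N -> forall y : int, ((y * B%:Z + x%:Z) %/ B%:Z)%Z = y.
  by move=> xB y; rewrite divzMDl ?divz_small ?addr0//; lia.
have kk : k = k' by rewrite -(h _ jB k) E h.
by split=> //; move: E; rewrite kk => /addrI [].
Qed.

Definition row_of (x : int) : int := (x %/ B%:Z)%Z.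

Lemma row_of_column k j : (j < B)%N -> row_of (column k j) = k.
Proof. by move=> jB; rewrite /row_of /column divzMDl ?divz_small ?addr0//; lia. Qed.

(* By pigeonhole over [i], if the whole row [k] is closed at time [n] then [bad_site k n i]
   for some [i]; the proportions (i + 1) / 2 ^ (i + 2) sum to 1. *)
Definition bad_site (k : int) (n i : nat) : set T :=
  [set w | (forall j, (j < B)%N -> (0 < N (column k j) n w)%N) /\
    (B * i.+1 <= 2 ^ i.+2 *
      count (fun j => 16 ^ i <= N (column k j) n w < 16 ^ i.+1) (iota 0 B))%N].

Lemma measurable_bad_site k n i : measurable (bad_site k n i).
Proof.
apply: measurableI.
  rewrite (_ : (fun w => _) =
    \bigcap_(j in [set j | (j < B)%N]) [set w | (0 < N (column k j) n w)%N]).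
    apply: bigcap_measurableType => j _.
    exact: (measurable_nat_event (N (column k j) n) [set l | (0 < l)%N]).
  by apply/seteqP; split => w h j; exact: h.
pose c w : K := \sum_(j <- iota 0 B) (16 ^ i <= N (column k j) n w < 16 ^ i.+1)%N%:R.
have mc : measurable_fun setT c.
  apply: measurable_sum => j.
  exact: (measurable_nat_fun (N (column k j) n) (fun l => (16 ^ i <= l < 16 ^ i.+1)%N%:R)).
rewrite (_ : (fun w => _) =
    setT `&` (fun w => (2 ^ i.+2)%:R * c w) @^-1` `[(B * i.+1)%:R, +oo[%classic).
  by apply: measurable_funM => //; exact: measurable_itv.
have cE w : (\sum_(j <- iota 0 B) (16 ^ i <= N (column k j) n w < 16 ^ i.+1) =
    count (fun j => 16 ^ i <= N (column k j) n w < 16 ^ i.+1) (iota 0 B))%N.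
  by rewrite -sum1_count [RHS]big_mkcond; apply: eq_bigr => j _; case: ifP.
by apply/seteqP; split => w /=; rewrite in_itv/= andbT /c -natr_sum -natrM ler_nat cE;
  [split|case].
Qed.

(** No factor vanishes since the row is closed, and each matching column contributes
    [expR (e * 2 ^+ i)]. The required proportion of such columns gives the exponent
    [e * B * (i + 1) / 4]. *)
Lemma bad_site_weight (e : K) k n i w : 0 < e -> bad_site k n i w ->
  expR (e * B%:R / 4) ^+ i.+1 <= \prod_(j <- iota 0 B) site_weight e i (N (column k j) n w).
Proof.
move=> e0 [pos cnt]; set a := fun j => (16 ^ i <= N (column k j) n w < 16 ^ i.+1)%N in cnt.
have -> : \prod_(j <- iota 0 B) site_weight e i (N (column k j) n w) =
    expR (e * 2 ^+ i * (count a (iota 0 B))%:R).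
  rewrite -sum1_count natr_sum mulr_sumr expR_sum [RHS]big_mkcond big_seq [RHS]big_seq.
  apply: eq_bigr => j; rewrite mem_iota /= add0n => jB.
  by rewrite /site_weight eqn0Ngt pos//= -/(a j); case: (a j); rewrite ?mulr1.
rewrite -expRM_natl ler_expR -!mulrA mulrCA ler_wpM2l ?(ltW e0)//.
suff : (B * i.+1)%:R <= (2 ^ i.+2 * count a (iota 0 B))%:R :> K.
  rewrite (natrM _ B) (natrM _ (2 ^ i.+2)%N) natrX 2!exprS.
  by set x := 2 ^+ i; set y := (count _ _)%:R; lra.
by rewrite ler_nat.
Qed.

Definition bad_cap (s : seq (int * (nat * nat))) : set T :=
  \big[setI/setT]_(f <- s) bad_site f.1 f.2.1 f.2.2.

Lemma measurable_bad_cap s : measurable (bad_cap s).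
Proof. by apply: bigsetI_measurable => f _; exact: measurable_bad_site. Qed.

Lemma bad_capP s w : bad_cap s w <-> forall f, f \in s -> bad_site f.1 f.2.1 f.2.2 w.
Proof. by rewrite /bad_cap -bigcap_seq. Qed.

(** Markov's inequality for the product of all site weights: on [bad_cap s] it is at least [C], and
    its expectation factors over the columns into terms at most 1. *)
Lemma bad_cap_le (e : K) (s : seq (int * (nat * nat))) : 0 < e ->
  (forall (X : nat -> {RV P >-> nat}) (s' : seq (nat * nat)),
    is_markov_chain (stationary K) (renewal_trans (interarrival K)) X ->
    uniq [seq (f.2, f.1 %/ 16 ^ f.2.+1)%N | f <- s'] ->
    (\int[P]_x (\prod_(f <- s') site_weight e f.2 (X f.1 x))%:E <= 1)%E) ->
  uniq [seq (f.1, (f.2.2, f.2.1 %/ 16 ^ f.2.2.+1)%N) | f <- s] ->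
  (P (bad_cap s) <= (\prod_(f <- s) expR (- (e * B%:R / 4)) ^+ f.2.2.+1)%:E)%E.
Proof.
move=> e0 He us; have [mN indep] := HN.
pose fam x := [seq f.2 | f <- s & f.1 == row_of x].
pose Z x w := \prod_(g <- fam x) site_weight e g.2 (N x g.1 w).
have HZ x : simple_for (process_sigma_algebra (N x)) (Z x).
  apply: simple_for_prod => [|A A'|g]; [exact: process_setT|exact: process_setI|].
  exact: site_weight_simple.
(* All entries used by column [x] lie in one row, so distinct walls mean distinct pairs of scale and
   interval. *)
have EZ x : (\int[P]_w (Z x w)%:E <= 1)%E.
  apply: He; first exact: mN.
  pose h (f : int * (nat * nat)) := (f.2.2, f.2.1 %/ 16 ^ f.2.2.+1)%N.
  set s' := [seq f <- s | f.1 == row_of x].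
  have us' : uniq [seq (f.1, h f) | f <- s'].
    by apply: subseq_uniq us; apply: map_subseq; exact: filter_subseq.
  rewrite /fam -map_comp; apply: (@map_uniq _ _ (pair (row_of x))).
  rewrite -map_comp; apply: etrans us'; congr uniq; apply/eq_in_map => f.
  by rewrite mem_filter => /andP[/eqP fx _] /=; rewrite /h fx.
(* The columns of all rows in [s]; [undup] is there because a row may hold several sites. *)
pose xs := [seq column k j | k <- undup [seq f.1 | f <- s], j <- iota 0 B].
have uxs : uniq xs.
  apply: allpairs_uniq; [exact: undup_uniq|exact: iota_uniq|].
  move=> [k j] [k' j'] /allpairsP[[a b] [_ /= bB [-> ->]]] /allpairsP[[a' b'] [_ /= b'B [-> ->]]].
  move: bB b'B; rewrite !mem_iota !add0n /= => bB b'B E.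
  by have [-> ->] := column_inj bB b'B E.
have Zprod w : \prod_(x <- xs) Z x w =
    \prod_(f <- s) \prod_(j <- iota 0 B) site_weight e f.2.2 (N (column f.1 j) f.2.1 w).
  rewrite /xs big_allpairs_dep /=.
  transitivity (\prod_(k <- undup [seq f.1 | f <- s]) \prod_(f <- s | f.1 == k)
      \prod_(j <- iota 0 B) site_weight e f.2.2 (N (column f.1 j) f.2.1 w)).
    apply: eq_bigr => k _; rewrite exchange_big /=; rewrite big_seq [RHS]big_seq.
    apply: eq_bigr => j; rewrite mem_iota /= add0n => jB.
    rewrite /Z /fam big_map big_filter row_of_column//.
    by apply: eq_bigr => f /eqP ->.
  rewrite (exchange_big_dep xpredT)//= big_seq [RHS]big_seq; apply: eq_bigr => f fs.
  have fu : f.1 \in undup [seq f.1 | f <- s] by rewrite mem_undup map_f.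
  rewrite big_mkcond (bigD1_seq f.1) ?undup_uniq//= eqxx [X in _ * X]big1 ?mulr1// => k kf.
  by rewrite eq_sym (negbTE kf).
set ka := expR (e * B%:R / 4).
have ka0 : 0 < ka by exact: expR_gt0.
have kaV : expR (- (e * B%:R / 4)) = ka^-1 by rewrite expRN.
pose C := \prod_(f <- s) ka ^+ f.2.2.+1.
have C0 : 0 < C by apply: prodr_gt0 => f _; rewrite exprn_gt0.
have -> : \prod_(f <- s) expR (- (e * B%:R / 4)) ^+ f.2.2.+1 = C^-1.
  by rewrite kaV /C -prodfV; apply: eq_bigr => f _; rewrite exprVn.
have H : (C%:E * P (bad_cap s) <= 1)%E.
  have mb := measurable_bad_cap s.
  have mZ x : measurable_fun setT (Z x).
    exact: simple_for_measurable (process_measurable (X := N x)) (HZ x).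
  apply: (@le_trans _ _ (\int[P]_w (\prod_(x <- xs) Z x w)%:E)%E).
    rewrite -[bad_cap s]setIT -integral_indic// -ge0_integralZl ?lee_fin ?(ltW C0)//; last first.
      by apply: measurable_EFin_fun; exact: measurable_indic.
    apply: ge0_le_integral => //.
    - by move=> w _; rewrite -EFinM lee_fin mulr_ge0// ltW.
    - apply: (measurable_EFin_fun (f := fun w => C * \1_(bad_cap s) w)).
      by apply: measurable_funM => //; exact: measurable_indic.
    - by apply: measurable_EFin_fun; apply: measurable_prod => x _.
    - move=> w _; rewrite -EFinM lee_fin Zprod indicE.
      have [wb|_] := boolP (w \in bad_cap s); last first.
        by rewrite mulr0; apply: prodr_ge0 => f _; apply: prodr_ge0 => j _; exact: site_weight_ge0.
      rewrite mulr1 /C big_seq [leRHS]big_seq; apply: ler_prod => f fs.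
      rewrite (exprn_ge0 _ (ltW ka0)) /=; apply: bad_site_weight => //.
      by move: wb; rewrite inE => /bad_capP; apply.
  have := independent_expectation (fun x => process_measurable (X := N x)) indep HZ
    (xs := xs) (ys := [::]) (A := fun=> setT).
  rewrite cats0 => /(_ uxs) I; have {}I := I (fun y _ => @process_setT (N y)).
  move: I; under eq_integral => w _ do rewrite big_nil mulr1.
  rewrite big_nil mule1 => -> //.
  elim: xs {uxs Zprod} => [|x xs IH]; first by rewrite big_nil.
  rewrite big_cons -[leRHS]mule1; apply: lee_pmul => //.
    by apply: integral_ge0 => w _; rewrite lee_fin; exact: simple_for_ge0 (HZ x).
  by apply: prode_ge0 => y _; apply: integral_ge0 => w _; rewrite lee_fin;
    exact: simple_for_ge0 (HZ y).
by rewrite -[(C^-1)%:E]mule1 -lee_pdivrMl ?invr_gt0// invrK.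
Qed.

End BadSites.

(** * Lipschitz percolation and the Peierls bound *)

(** The partial sum of the proportions [(i + 1) / 2 ^ (i + 2)], cleared of denominators; the defect
    [M.+3] makes it strictly less than 1. *)
Lemma weighted_pow_sum M : (\sum_(i < M.+1) 2 ^ (M - i) * i.+1 + M.+3 = 2 ^ M.+2)%N.
Proof.
elim: M => [|M IH]; first by rewrite big_ord1.
rewrite big_ord_recr /= subnn mul1n.
have -> : (\sum_(i < M.+1) 2 ^ (M.+1 - i) * i.+1 = 2 * \sum_(i < M.+1) 2 ^ (M - i) * i.+1)%N.
  rewrite big_distrr; apply: eq_bigr => i _ /=.
  by rewrite mulnA -expnS subSn// -ltnS.
by rewrite expnS -IH; lia.
Qed.

(** Each positive [l j] has exactly one scale, [trunc_log 16 (l j)], so the counts add up to [B]. If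
    all fell short of their shares, their sum would be below [B]. *)
Lemma scale_pigeonhole B (l : nat -> nat) : (0 < B)%N -> (forall j, (j < B)%N -> (0 < l j)%N) ->
  exists i, (B * i.+1 <= 2 ^ i.+2 * count (fun j => 16 ^ i <= l j < 16 ^ i.+1) (iota 0 B))%N.
Proof.
move=> B0 l0; apply: contrapT => /forallNP H.
pose M := (\max_(j < B) l j)%N.
pose cnt i := count (fun j => 16 ^ i <= l j < 16 ^ i.+1)%N (iota 0 B).
have lM j : (j < B)%N -> (trunc_log 16 (l j) < M.+1)%N.
  move=> jB; rewrite ltnS; apply: (@leq_trans (l j)).
    by apply: leq_trans (trunc_logP (isT : 1 < 16)%N (l0 _ jB)); rewrite ltnW// ltn_expl.
  exact: (@leq_bigmax _ (fun j : 'I_B => l j) (Ordinal jB)).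
have E : (\sum_(i < M.+1) cnt i = B)%N.
  under eq_bigr => i _ do rewrite /cnt -sum1_count.
  rewrite (exchange_big_dep xpredT)//= -[RHS]muln1.
  rewrite -[X in (X * 1)%N](size_iota 0 B) -sum1_size big_distrl/=.
  rewrite big_seq [RHS]big_seq; apply: eq_bigr => j; rewrite mem_iota /= add0n => jB.
  rewrite (big_pred1 (Ordinal (lM _ jB))) => [//|i] /=.
  apply/idP/eqP => [lij|->]; last exact: trunc_log_bounds (l0 _ jB).
  by apply: val_inj => /=; rewrite (trunc_log_eq _ lij).
have : (B * 2 ^ M.+2 <= B * \sum_(i < M.+1) 2 ^ (M - i) * i.+1)%N.
  rewrite -{1}E big_distrl big_distrr /=; apply: leq_sum => i _.
  have := H i; rewrite -/(cnt i) => /negP; rewrite -ltnNge => /ltnW h.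
  have -> : (2 ^ M.+2 = 2 ^ (M - i) * 2 ^ i.+2)%N.
    by rewrite -expnD; congr (2 ^ _)%N; have := ltn_ord i; lia.
  by rewrite [leqLHS]mulnC -mulnA [leqRHS]mulnCA leq_mul2l h orbT.
rewrite -(weighted_pow_sum M) leq_pmul2l//; lia.
Qed.

Section Reachability.
Variable bad : int -> nat -> nat -> Prop.

(* Lipschitz percolation (Dirr, Dondl, Grimmett, Holroyd, Scheutzow): from the rows
   [k <= 0] one may move down diagonally for free, and up across a bad wall, that is a
   16-adic time interval of row [k] containing a bad site of its own scale. The lowest
   rows that cannot be reached form a Lipschitz graph without bad sites. *)
Fixpoint reach (h n : nat) (k : int) : Prop :=
  if h is h'.+1 then
    [\/ reach h' n.+1 (k + 1), reach h' n.-1 (k + 1) |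
        exists i n1 n2, [/\ (n1 %/ 16 ^ i.+1 = n %/ 16 ^ i.+1)%N,
          (n2 %/ 16 ^ i.+1 = n %/ 16 ^ i.+1)%N, bad k n2 i & reach h' n1 (k - 1)]]
  else k <= 0.

Definition reachable n k := exists h, reach h n k.

Definition frontier n k := ~ reachable n k /\ forall j, j < k -> reachable n j.

Lemma reachable_next n k : reachable n k -> reachable n.+1 (k - 1).
Proof. by move=> [h hk]; exists h.+1; constructor 2; rewrite subrK. Qed.

Lemma reachable_prev n k : reachable n.+1 k -> reachable n (k - 1).
Proof. by move=> [h hk]; exists h.+1; constructor 1; rewrite subrK. Qed.

(** The row below is reachable, and a bad site would allow moving up across its wall. *)
Lemma frontier_not_bad n k i : frontier n k -> ~ bad k n i.
Proof.
move=> [nr lo] b; apply: nr.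
have [h hk] : reachable n (k - 1) by apply: lo; lia.
by exists h.+1; constructor 3; exists i, n, n.
Qed.

(** Diagonal moves down make every row below [k - 1] reachable at the next time; applied backwards,
    they show that [k + 1] is not. *)
Lemma frontier_step n k : frontier n k -> exists k', `|k' - k| <= 1 /\ frontier n.+1 k'.
Proof.
move=> [nr lo].
have lo' j : j < k - 1 -> reachable n.+1 j.
  by move=> jk; rewrite -(addrK 1 j); apply: reachable_next; apply: lo; lia.
have hi : ~ reachable n.+1 (k + 1).
  by move=> /reachable_prev; rewrite addrK.
have [r1|r1] := pselect (reachable n.+1 (k - 1)); last first.
  by exists (k - 1); split; [lia|split].
have lo1 j : j < k -> reachable n.+1 j.
  move=> jk; have [->//|jk1] := eqVneq j (k - 1); apply: lo'; lia.
have [r2|r2] := pselect (reachable n.+1 k); last first.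
  by exists k; split; [lia|split].
exists (k + 1); split; [lia|split] => // j jk.
have [->//|jk1] := eqVneq j k; apply: lo1; lia.
Qed.

Lemma lipschitz_path : ~ reachable 0 1 -> exists F : nat -> int,
  [/\ F 0%N = 1, forall n, `|F n.+1 - F n| <= 1 & forall n i, ~ bad (F n) n i].
Proof.
move=> nr.
have f0 : frontier 0 1.
  by split => // j j1; exists 0%N => /=; lia.
pose S := {nk : nat * int | frontier nk.1 nk.2}.
have step (s : S) : exists s' : S, (sval s').1 = (sval s).1.+1 /\ `|(sval s').2 - (sval s).2| <= 1.
  case: s => [[n k] /= fk]; have [k' [kk fk']] := frontier_step fk.
  by exists (exist _ (n.+1, k') fk').
have [g Hg] := choice step.
pose st n := iter n g (exist _ (0%N, 1) f0 : S).
have st1 n : (sval (st n)).1 = n by elim: n => // n IH; rewrite /st iterS (Hg _).1 IH.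
exists (fun n => (sval (st n)).2); split=> // [n|n i].
  by rewrite {1}/st iterS; exact: (Hg _).2.
rewrite -{2}(st1 n); apply: frontier_not_bad; exact: (svalP (st n)).
Qed.

End Reachability.

Definition wall (f : int * (nat * nat)) := (f.1, (f.2.2, f.2.1 %/ 16 ^ f.2.2.+1)%N).

(** * Union bound over paths of moves *)

Section UnionBound.
Context (K : realType) (d : measure_display) (T : measurableType d) (P : probability T K).
Variables (N : int -> nat -> {RV P >-> nat}) (B : nat).

(* Paths of [h] moves ending at [(n, k)], followed backwards; [c] collects the bad sites used,
   in pairwise distinct walls. *)
Fixpoint chain_event (c : seq (int * (nat * nat))) (h n : nat) (k : int) : set T :=
  if h is h'.+1 then
    chain_event c h' n.+1 (k + 1) `|` chain_event c h' n.-1 (k + 1) `|`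
    \bigcup_i \big[setU/set0]_(r1 < 16 ^ i.+1) \big[setU/set0]_(r2 < 16 ^ i.+1)
      chain_event ((k, (n %/ 16 ^ i.+1 * 16 ^ i.+1 + r2, i)%N) :: c) h'
        (n %/ 16 ^ i.+1 * 16 ^ i.+1 + r1)%N (k - 1)
  else if (k <= 0) && uniq [seq wall f | f <- c] then bad_cap N B c else set0.

(* A path with the least number of moves never uses the same wall twice. *)
Lemma geodesic_chain w (bad := fun k n i => bad_site N B k n i w) h c n k :
  uniq [seq wall f | f <- c] -> (forall f, f \in c -> bad f.1 f.2.1 f.2.2) ->
  (forall f, f \in c -> exists m, (m %/ 16 ^ f.2.2.+1 = f.2.1 %/ 16 ^ f.2.2.+1)%N /\
    forall h', (h' <= h)%N -> ~ reach bad h' m f.1) ->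
  reach bad h n k -> (forall h', (h' < h)%N -> ~ reach bad h' n k) ->
  chain_event c h n k w.
Proof.
elim: h c n k => [|h IH] c n k uc bc far /=.
  by move=> k0 _; rewrite k0 uc; apply/bad_capP.
(* For each collected site, [far] provides a time [m] in its wall at which its row is out of reach
   within the remaining number of moves. *)
have far' f : f \in c -> exists m, (m %/ 16 ^ f.2.2.+1 = f.2.1 %/ 16 ^ f.2.2.+1)%N /\
    forall h', (h' <= h)%N -> ~ reach bad h' m f.1.
  by move=> /far[m [mf H]]; exists m; split=> // h' hh; apply: H; rewrite leqW.
move=> [r|r|[i [n1 [n2 [e1 e2 b r]]]]] min.
- left; left; apply: IH => // h' hh rr; apply: (min h'.+1) => //=; exact: Or31.
- left; right; apply: IH => // h' hh rr; apply: (min h'.+1) => //=; exact: Or32.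
right; exists i => //; set D := (16 ^ i.+1)%N in e1 e2 *.
have D0 : (0 < D)%N by rewrite expn_gt0.
have dE m : (m %/ D = n %/ D)%N -> (n %/ D * D + m %% D = m)%N.
  by move=> <-; rewrite -divn_eq.
rewrite (bigD1 (Ordinal (ltn_pmod n1 D0)))//=; left.
rewrite (bigD1 (Ordinal (ltn_pmod n2 D0)))//=; left.
rewrite /= !dE//; apply: IH => //.
(* If the wall of [f] were used again, one move from [n1] would lead straight to the time [m], too
   early for [far]. *)
- rewrite /= uc andbT; apply/negP => /mapP[f fc]; rewrite /wall /= => -[kf [iff e]].
  have [m [mf H]] := far f fc; apply: (H h.+1) => //=; rewrite -kf; apply: Or33.
  exists i, n1, n2; move: mf; rewrite -e -iff -/D => mf.
  by split=> //; rewrite ?e1 mf ?e2 //.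
- by move=> f; rewrite inE => /orP[/eqP ->//|]; exact: bc.
(* For the new site this time is [n], by minimality of the path. *)
- move=> f; rewrite inE => /orP[/eqP -> /=|]; last exact: far'.
  by exists n; split; [rewrite e2|move=> h' hh; apply: min; rewrite ltnS].
- move=> h' hh rr; apply: (min h'.+1) => //=; apply: Or33; by exists i, n1, n2.
Qed.

Lemma reachable_chain w n k : reachable (fun k n i => bad_site N B k n i w) n k ->
  exists h, chain_event [::] h n k w.
Proof.
move=> [h0 r0]; pose p h := `[< reach (fun k n i => bad_site N B k n i w) h n k >].
have ep : exists h, p h by exists h0; exact/asboolP.
case: (ex_minnP ep) => h /asboolP r min; exists h; apply: geodesic_chain => // h' hh rr.
by have := min h' (asboolT rr); rewrite leqNgt hh.
Qed.

Lemma measurable_chain_event c h n k : measurable (chain_event c h n k).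
Proof.
elim: h c n k => [|h IH] c n k /=; first by case: ifP => // _; exact: measurable_bad_cap.
apply: measurableU; first exact: measurableU.
apply: bigcup_measurable => i _; apply: bigsetU_measurable => r1 _.
by apply: bigsetU_measurable => r2 _.
Qed.

Lemma geometric_sum_le (x : K) : 0 <= x <= 2^-1 -> (\sum_(i <oo) (x ^+ i.+1)%:E <= (2 * x)%:E)%E.
Proof.
move=> /andP[x0 x1]; apply: lime_le.
  by apply: is_cvg_nneseries => j _ _; rewrite lee_fin exprn_ge0.
apply: nearW => n; rewrite sumEFin lee_fin.
have E : (\sum_(0 <= i < n) x ^+ i.+1) * (1 - x) = x - x ^+ n.+1.
  elim: n => [|n IH]; first by rewrite big_geq// mul0r expr1 subrr.
  rewrite big_nat_recr//= mulrDl IH [x ^+ n.+2]exprS; ring.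
have S0 : 0 <= \sum_(0 <= i < n) x ^+ i.+1 by apply: sumr_ge0 => *; rewrite exprn_ge0.
have xn : 0 <= x ^+ n.+1 by rewrite exprn_ge0.
nra.
Qed.

(** The factor [y ^ k] acts as a potential in the height. Each of the two moves down brings a factor
    [y]; a move up brings [1 / y] times a sum over scales and positions. Paths start at [k <= 0],
    where [y ^ k >= 1]. *)
Lemma chain_event_le (ka y : K) c h n k : 0 < ka -> 16 ^+ 2 * ka <= 2^-1 -> 0 < y <= 1 ->
  (forall s, uniq [seq wall f | f <- s] ->
    (P (bad_cap N B s) <= (\prod_(f <- s) ka ^+ f.2.2.+1)%:E)%E) ->
  (P (chain_event c h n k) <=
    (\prod_(f <- c) ka ^+ f.2.2.+1 * (2 * y + 2 * (16 ^+ 2 * ka) / y) ^+ h * y ^ k)%:E)%E.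
Proof.
move=> ka0 ka1 /andP[y0 y1] Hs; set s := 2 * y + _.
have s0 : 0 <= s.
  by apply: addr_ge0; rewrite ?divr_ge0 ?mulr_ge0// ltW.
have Pc0 c' : 0 <= \prod_(f <- c') ka ^+ f.2.2.+1.
  by apply: prodr_ge0 => f _; rewrite exprn_ge0 ?ltW.
have yk0 (m : int) : 0 < y ^ m by exact: exprz_gt0.
elim: h c n k => [|h IH] c n k.
  rewrite /= expr0 mulr1; case: ifP => [/andP[k0 uc]|_]; last first.
    by rewrite measure0 lee_fin mulr_ge0 ?Pc0 ?ltW.
  apply: le_trans (Hs _ uc) _; rewrite lee_fin ler_peMr ?Pc0//.
  case: k k0 => [[|m]|m] //= _.
  change (1 <= (y ^+ m.+1)^-1); rewrite invf_ge1 ?exprn_gt0//.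
  by apply: exprn_ile1 => //; exact: ltW.
have yS : y ^ (k + 1) = y ^ k * y by rewrite expfzDr ?gt_eqF.
have yP : y ^ (k - 1) = y ^ k / y by rewrite expfzDr ?gt_eqF// exprN1.
rewrite /=.
set A1 := chain_event c h n.+1 _; set A2 := chain_event c h n.-1 _; set A3 := \bigcup_i _.
have mA1 : measurable A1 by exact: measurable_chain_event.
have mA2 : measurable A2 by exact: measurable_chain_event.
have mA3i i : measurable (\big[setU/set0]_(r1 < 16 ^ i.+1) \big[setU/set0]_(r2 < 16 ^ i.+1)
      chain_event ((k, (n %/ 16 ^ i.+1 * 16 ^ i.+1 + r2, i)%N) :: c) h
        (n %/ 16 ^ i.+1 * 16 ^ i.+1 + r1)%N (k - 1)).
  apply: bigsetU_measurable => r1 _; apply: bigsetU_measurable => r2 _.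
  exact: measurable_chain_event.
have mA3 : measurable A3 by apply: bigcup_measurable => i _; exact: mA3i.
set C := \prod_(f <- c) ka ^+ f.2.2.+1.
(* At scale [i] there are [(16 ^ i.+1) ^ 2] choices of [r1] and [r2]; with [ka ^+ i.+1] they form a
   geometric series of ratio [16 ^+ 2 * ka]. *)
have E3 : (P A3 <= (C * s ^+ h * y ^ k * (2 * (16 ^+ 2 * ka) / y))%:E)%E.
  apply: (le_trans (generalized_Boole_inequality P mA3i mA3)).
  apply: (@le_trans _ _ (\sum_(i <oo) (C * s ^+ h * y ^ k / y)%:E * ((16 ^+ 2 * ka) ^+ i.+1)%:E)%E).
    apply: lee_nneseries => // i _.
    set D := (16 ^ i.+1)%N; set a := (n %/ D)%N.
    pose G r1 r2 := chain_event ((k, (a * D + r2, i)%N) :: c) h (a * D + r1)%N (k - 1).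
    have mG r1 r2 : measurable (G r1 r2) by exact: measurable_chain_event.
    pose b := ka ^+ i.+1 * (C * s ^+ h * y ^ k / y).
    have bG r1 r2 : (P (G r1 r2) <= b%:E)%E.
      apply: le_trans (IH _ _ _) _; rewrite lee_fin big_cons /= yP /b -/C le_eqVlt.
      by apply/orP; left; apply/eqP; ring.
    have mG1 r1 : measurable (\big[setU/set0]_(r2 < D) G r1 r2).
      by apply: bigsetU_measurable => r2 _.
    apply: (@le_trans _ _ (\sum_(r1 < D) P (\big[setU/set0]_(r2 < D) G r1 r2))%E).
      exact: (@Boole_inequality _ _ _ P (fun r1 => \big[setU/set0]_(r2 < D) G r1 r2) D
        (fun _ _ => mG1 _)).
    apply: (@le_trans _ _ (\sum_(r1 < D) \sum_(r2 < D) b%:E)%E).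
      apply: lee_sum => r1 _.
      apply: (le_trans (@Boole_inequality _ _ _ P (G r1) D (fun _ _ => mG r1 _))).
      by apply: lee_sum => r2 _; exact: bG.
    rewrite 2!sumEFin !sumr_const !card_ord -EFinM lee_fin le_eqVlt; apply/orP; left; apply/eqP.
    rewrite -mulrnA -[LHS]mulr_natl /b exprMn.
    rewrite (_ : (D * D)%:R = (16 ^+ 2) ^+ i.+1 :> K); first by ring.
    by rewrite -natrX -natrX -expnM mulnC expnM mulnn.
  rewrite nneseriesZl; last by move=> i _; rewrite lee_fin exprn_ge0// mulr_ge0// ltW.
  apply: (@le_trans _ _ ((C * s ^+ h * y ^ k / y)%:E * (2 * (16 ^+ 2 * ka))%:E)%E).
    apply: lee_wpmul2l; first by rewrite lee_fin divr_ge0 ?mulr_ge0 ?exprn_ge0 ?Pc0// ltW.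
    by apply: geometric_sum_le; rewrite ka1 andbT mulr_ge0// ltW.
  rewrite -EFinM lee_fin le_eqVlt; apply/orP; left; apply/eqP; ring.
have U12 : (P (A1 `|` A2) <= P A1 + P A2)%E by exact: measureU2.
have U : (P (A1 `|` A2 `|` A3) <= P A1 + P A2 + P A3)%E.
  apply: le_trans (measureU2 _ _ _) _ => //; first exact: measurableU.
  exact: leeD2r.
apply: (le_trans U).
apply: (le_trans (leeD (leeD (IH c n.+1 (k + 1)) (IH c n.-1 (k + 1))) E3)).
rewrite -!EFinD lee_fin -/C yS (exprS s h) le_eqVlt; apply/orP; left; apply/eqP.
by set sh := s ^+ h; rewrite /s; ring.
Qed.

End UnionBound.

(** * Infinite open paths *)

Section OpenPaths.
Variables (adj : rel int) (op : int -> nat -> Prop).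

Fixpoint open_path_from (h n : nat) (x : int) : Prop :=
  op x n /\ (if h is h'.+1 then exists2 y, adj x y & open_path_from h' n.+1 y else True).

Lemma open_path_from_le h h' n x : (h <= h')%N -> open_path_from h' n x -> open_path_from h n x.
Proof.
elim: h h' n x => [|h IH] [|h'] n x //=; first by move=> _ [].
by move=> hh [ox [y xy py]]; split=> //; exists y => //; exact: IH py.
Qed.

(** Koenig's lemma: steps of bounded size leave finitely many successors, so one of them starts open
    paths of every length. *)
Lemma open_path_koenig (r : nat) : (forall x y, adj x y -> `|y - x| <= r%:Z) ->
  forall x0, (forall h, open_path_from h 0 x0) <->
  exists g : nat -> int, [/\ g 0%N = x0, forall n, adj (g n) (g n.+1) & forall n, op (g n) n].
Proof.
move=> Hr x0; split=> [H0|[g [<- gadj gop]] h]; last first.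
  elim: h 0%N => [|h IH] n /=; split=> //; exists (g n.+1) => //; exact: IH.
have step n x : (forall h, open_path_from h n x) ->
    exists y, adj x y /\ forall h, open_path_from h n.+1 y.
  move=> Hx; apply: contrapT => /forallNP no.
  have bad y : exists h, adj x y -> ~ open_path_from h n.+1 y.
    have /not_andP[na|/existsNP[h nh]] := no y; first by exists 0%N.
    by exists h.
  have [hy Hhy] := choice bad.
  (* The sites within distance [r] of [x]; the largest of their failing lengths contradicts [Hx]. *)
  pose z (i : nat) : int := x - r%:Z + i%:Z.
  pose H := (\max_(i < (2 * r).+1) hy (z i))%N.
  have [_ [y xy /= py]] := Hx H.+1.
  have yr := Hr _ _ xy.
  have ib : (absz (y - x + r%:Z)%R < (2 * r).+1)%N by lia.
  have zy : z (absz (y - x + r%:Z)%R) = y by rewrite /z; lia.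
  apply: (Hhy y xy); apply: open_path_from_le py; rewrite -zy.
  exact: (@leq_bigmax _ (fun i : 'I__ => hy (z i)) (Ordinal ib)).
pose S := {nx : nat * int | forall h, open_path_from h nx.1 nx.2}.
have stepS (s : S) : exists s' : S, (sval s').1 = (sval s).1.+1 /\ adj (sval s).2 (sval s').2.
  case: s => [[n x] /= Hx]; have [y [xy Hy]] := step _ _ Hx.
  by exists (exist _ (n.+1, y) Hy).
have [f Hf] := choice stepS.
pose st n := iter n f (exist _ (0%N, x0) H0 : S).
have st1 n : (sval (st n)).1 = n by elim: n => // n IH; rewrite /st iterS (Hf _).1 IH.
exists (fun n => (sval (st n)).2); split=> // n.
  by rewrite {2}/st iterS; exact: (Hf _).2.
by have := svalP (st n) 0%N; rewrite st1 => -[].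
Qed.

End OpenPaths.

(** * The percolation event *)

Section Percolation.
Context (K : realType) (d : measure_display) (T : measurableType d) (P : probability T K).
Variable N : int -> nat -> {RV P >-> nat}.

Definition percolation (R : K) : set T := [set w | exists g : nat -> int,
  [/\ g 0%N = 0%R, forall n : nat, (`|g n.+1 - g n|%:~R <= R)%R &
      forall n : nat, N (g n) n w = 0%N]].

(** The event quantifies over uncountably many paths; Koenig's lemma rewrites it with countable
    operations. *)
Lemma measurable_percolation R : measurable (percolation R).
Proof.
pose adj (x y : int) := (`|y - x|%:~R <= R)%R.
pose op w (x : int) n := N x n w = 0%N.
have -> : percolation R = \bigcap_h [set w | open_path_from adj (op w) h 0 0].
  have adjr x y : adj x y -> `|y - x| <= (Num.truncn R).+1%:Z.
    move=> xy; rewrite -(ler_int K); apply: (le_trans xy).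
    by rewrite -pmulrn ltW// truncnS_gt.
  apply/seteqP; split => w /=.
    by move=> Hw h _; move: h; apply/(open_path_koenig (op w) adjr).
  by move=> Hw; apply/(open_path_koenig (op w) adjr) => h; exact: Hw.
apply: bigcap_measurableType => h _.
elim: h 0%N (0 : int) => [|h IH] n x /=.
  rewrite (_ : (fun w => _) = [set w | N x n w = 0%N]).
    exact: (measurable_nat_event (N x n) [set 0%N]).
  by apply/seteqP; split=> w //= [].
rewrite (_ : (fun w => _) = [set w | N x n w = 0%N] `&`
  \bigcup_y (if adj x y then [set w | open_path_from adj (op w) h n.+1 y] else set0)).
  apply: measurableI; first exact: (measurable_nat_event (N x n) [set 0%N]).
  by apply: countable_bigcupT_measurable => // y; case: ifP => // _; exact: IH.
apply/seteqP; split => w /= [ox].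
  by move=> [y xy py]; split => //; exists y => //; rewrite xy.
by move=> [y _]; case: ifP => // xy py; split => //; exists y.
Qed.

(** A row without a bad site has an open column, by [scale_pigeonhole]; choosing one along the
    Lipschitz graph gives the path. *)
Lemma not_reachable_percolation (B : nat) (R : K) w : (0 < B)%N -> (3 * B)%:R <= R ->
  N 0 0%N w = 0%N -> ~ reachable (fun k n i => bad_site N B k n i w) 0 1 ->
  percolation R w.
Proof.
move=> B0 BR N0 /lipschitz_path[F [F0 F1 Fb]].
have open n : exists j, (j < B)%N /\ N (column B (F n) j) n w = 0%N.
  apply: contrapT => /forallNP no.
  have pos j : (j < B)%N -> (0 < N (column B (F n) j) n w)%N.
    by move=> jB; rewrite lt0n; apply/eqP => e; apply: (no j).
  have [i Hi] := scale_pigeonhole B0 pos.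
  exact: (Fb n i).
have [j Hj] := choice open.
(* The graph starts in row 1, so the origin replaces its first site. Row [F 1] is 0, 1 or 2, hence
   the first jump is less than [3 * B]; later ones are less than [2 * B]. *)
exists (fun n => if n is n'.+1 then column B (F n) (j n) else 0); split=> // [n|[|n]//]; last first.
  exact: (Hj n.+1).2.
apply: le_trans BR; rewrite -[(3 * B)%:R]/((3 * B)%:R) pmulrn ler_int.
have j1 := (Hj n.+1).1; have j0 := (Hj n).1; have := F1 n.
rewrite /column; case: n j0 j1 => [|n] j0 j1.
  rewrite F0 subr0 => f1.
  have [->|[->|->]] : F 1%N = 0 \/ F 1%N = 1 \/ F 1%N = 2 by lia.
  - lia.
  - lia.
  - lia.
move=> f1; have [->|[->|->]] : F n.+2 = F n.+1 - 1 \/ F n.+2 = F n.+1 \/ F n.+2 = F n.+1 + 1 by lia.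
all: rewrite ?mulrDl ?mulrBl; lia.
Qed.

End Percolation.

Theorem mainTheorem6 (K : realType) :
  exists R0 : K, forall R : K, R0 <= R ->
  forall (d : measure_display) (T : measurableType d) (P : probability T K)
    (N : int -> nat -> {RV P >-> nat}),
    renewal_family N ->
    (0 < P [set w | exists g : nat -> int,
              [/\ g 0%N = 0%R,
                  forall n : nat, (`|g n.+1 - g n|%:~R <= R)%R &
                  forall n : nat, N (g n) n w = 0%N]])%E.
Proof.
have [e e0 He] := family_expectation_le1 K.
have q0 := stationary0_gt0 K.
(* [y < q_0] will make unwanted reachability less likely than an open origin, and [y <= 1/8] bounds
   the first term of [s] by 1/4. *)
pose y : K := Num.min 8^-1 (stationary K 0 / 2).
have y0 : 0 < y by rewrite lt_min invr_gt0 ltr0n divr_gt0.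
have y8 : y <= 8^-1 by rewrite ge_min lexx.
have yq : y < stationary K 0.
  by apply: (@le_lt_trans _ _ (stationary K 0 / 2)); [rewrite ge_min lexx orbT|lra].
pose L : K := 16 ^+ 2.
have L0 : 0 < L by rewrite exprn_gt0.
(* Large enough for [expR (e * B / 4) >= 8 * L / y], by [expR x >= 1 + x]; the second term of [s] is
   then at most 1/4. *)
pose B := (Num.truncn (4 * (8 * L / y) / e)).+1.
have B0 : (0 < B)%N by [].
pose ka := expR (- (e * B%:R / 4)).
have ka0 : 0 < ka by exact: expR_gt0.
have kay : L * ka <= y / 8.
  rewrite -ler_pdivlMl// /ka expRN invf_ple ?posrE ?expR_gt0 ?mulr_gt0 ?invr_gt0//.
  have : 4 * (8 * L / y) / e < B%:R by rewrite truncnS_gt.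
  rewrite ltr_pdivrMr// => h; apply: le_trans (expR_ge1Dx _).
  have -> : (L^-1 * (y / 8))^-1 = 8 * L / y by rewrite !invfM !invrK mulrCA mulrC (mulrC L).
  by move: h; move: (8 * L / y) => z; lra.
have ka1 : L * ka <= 2^-1 by lra.
have y1 : 0 < y <= 1 by rewrite y0/=; lra.
pose s := 2 * y + 2 * (L * ka) / y.
have Lka0 : 0 <= L * ka by rewrite mulr_ge0// ltW.
have s0 : 0 <= s by apply: addr_ge0; rewrite ?divr_ge0 ?mulr_ge0 ?ltW.
have s1 : s <= 2^-1.
  have : 2 * (L * ka) / y <= 4^-1 by rewrite ler_pdivrMr//; lra.
  rewrite /s; lra.
exists (3 * B)%:R => R BR d T P N HN.
rewrite -/(percolation N R).
have core c : uniq [seq wall f | f <- c] ->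
    (P (bad_cap N B c) <= (\prod_(f <- c) ka ^+ f.2.2.+1)%:E)%E.
  by move=> uc; apply: (bad_cap_le HN B0 e0) => // X s' mX us'; exact: He.
pose D := \bigcup_h chain_event N B [::] h 0 1.
have mD : measurable D by apply: bigcup_measurable => h _; exact: measurable_chain_event.
have PD : (P D <= y%:E)%E.
  apply: (le_trans (generalized_Boole_inequality P
    (fun h => measurable_chain_event N B [::] h 0 1) mD)).
  (* No path of 0 moves ends in row 1, so the sum starts at [h = 1] and is at most
     [2 * s * y <= y]. *)
  rewrite nneseries_recS//= measure0 add0e.
  apply: (@le_trans _ _ (\sum_(h <oo) y%:E * (s ^+ h.+1)%:E)%E).
    apply: lee_nneseries => // h _.
    apply: (le_trans (chain_event_le [::] h.+1 0 1 ka0 ka1 y1 core)).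
    by rewrite big_nil mul1r expr1z -EFinM mulrC.
  rewrite nneseriesZl; last by move=> h _; rewrite lee_fin exprn_ge0.
  apply: (@le_trans _ _ (y%:E * (2 * s)%:E)%E).
    apply: lee_wpmul2l; first by rewrite lee_fin ltW.
    by apply: geometric_sum_le; rewrite s0.
  by rewrite -EFinM lee_fin ler_piMr ?(ltW y0)//; lra.
have mE := measurable_percolation N R.
pose A0 := [set w | N 0 0%N w = 0%N].
have mA0 : measurable A0 by exact: (measurable_nat_event (N 0 0%N) [set 0%N]).
have PA0 : P A0 = (stationary K 0)%:E by have [/(_ 0) [/(_ 0%N)]] := HN.
rewrite lt_neqAle measure_ge0 andbT; apply/negP => /eqP E0.
(* An open origin outside [D] percolates, so a null percolation event would force [q_0 <= y]. *)
have : (P A0 <= P (percolation N R) + P D)%E.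
  apply: (@le_trans _ _ (P (percolation N R `|` D))); last exact: measureU2.
  apply: le_measure; rewrite ?inE//; first exact: measurableU.
  move=> w A0w; have [Dw|nD] := pselect (D w); [by right|left].
  apply: (not_reachable_percolation B0 BR A0w) => /reachable_chain[h hw].
  by apply: nD; exists h.
rewrite -E0 add0e PA0 => /le_trans /(_ PD); rewrite lee_fin leNgt yq.
by [].
Qed.
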